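(* Let $\{p_n\}_{n=1}^\infty$ be a probability distribution on $\mathbb{N}=\{1,2,\dots\}$ with $p_j>0$ for all $j\in\mathbb{N}$, and assume that the sequence $\{p_n\}_{n=1}^\infty$ is non-increasing. Then for all $k\in\mathbb{N}$, $$ \lim_{l\to\infty}\lim_{n\to\infty}P_n^{(\{p_j\}_{j=1}^\infty)}(A^{(n)}_{l;k})=\Big(\prod_{j=1}^{k-1}\sum_{i=1}^jp_i\Big)\Big(\prod_{j=1}^\infty\sum_{i=1}^jp_i\Big). $$ Also, if $\{k_n\}_{n=1}^\infty$ is a sequence of positive integers with $\lim_{n\to\infty}\min(k_n,n-k_n)=\infty$, then $$ \lim_{l\to\infty}\liminf_{n\to\infty}P_n^{(\{p_j\}_{j=1}^\infty)}(A^{(n)}_{l;k_n})= \lim_{l\to\infty}\limsup_{n\to\infty}P_n^{(\{p_j\}_{j=1}^\infty)}(A^{(n)}_{l;k_n})= \Big(\prod_{j=1}^\infty\sum_{i=1}^jp_i\Big)^2. $$ In particular, these limits are positive if and only if $\sum_{n=1}^\infty np_n<\infty$, or equivalently, if and only if the $p$-shifted random permutation is positive recurrent.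
   Context: $S_n$ is the set of permutations $\sigma=\sigma_1\cdots\sigma_n$ of $[n]=\{1,\dots,n\}$, and $S_\infty$ is the set of permutations $\sigma=\sigma_1\sigma_2\cdots$ of $\mathbb{N}$. For $l\ge2$ and $1\le k\le n-l+1$, $A^{(n)}_{l;k}\subset S_n$ is the event that the set of $l$ consecutive numbers $\{k,k+1,\dots,k+l-1\}$ appears in a set of $l$ consecutive positions, i.e. there exists $m\in\{1,\dots,n-l+1\}$ with $\{k,k+1,\dots,k+l-1\}=\{\sigma_m,\dots,\sigma_{m+l-1}\}$. $p$-shifted distributions: let $p=\{p_j\}_{j=1}^\infty$ be a probability distribution on $\mathbb{N}$ with $p_j>0$ for all $j$. Take i.i.d. samples $n_1,n_2,\dots$ from $p$. Define the random permutation $\Pi\in S_\infty$ by $\Pi_1=n_1$ and, for $k\ge2$, $\Pi_k=\psi_k(n_k)$, where $\psi_k$ is the increasing bijection from $\mathbb{N}$ to $\mathbb{N}-\{\Pi_1,\dots,\Pi_{k-1}\}$. The law of $\Pi$ on $S_\infty$ is $P^{(\{p_j\}_{j=1}^\infty)}$, the $p$-shifted distribution; $\Pi$ is the $p$-shifted random permutation. For $\sigma\in S_\infty$, $\mathrm{proj}_n(\sigma)\in S_n$ is obtained from $\sigma=\sigma_1\sigma_2\cdots$ by deleting every $\sigma_i$ with $\sigma_i>n$. $P_n^{(\{p_j\}_{j=1}^\infty)}$ is the law of $\mathrm{proj}_n(\Pi)$ on $S_n$. Positive recurrence: let $T_1=\inf\{m\ge1:\Pi([m])=[m]\}$ be the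 first renewal number of $\Pi$ (with $T_1=\infty$ if there is none). The $p$-shifted random permutation (or distribution) is called positive recurrent if $E^{(\{p_j\}_{j=1}^\infty)}T_1<\infty$, where $E^{(\{p_j\}_{j=1}^\infty)}$ is expectation under $P^{(\{p_j\}_{j=1}^\infty)}$. *)

(* Defs.v *)
From HB Require Import structures.
From mathcomp Require Import all_boot all_order all_fingroup all_algebra.
From mathcomp Require Import all_classical all_reals all_analysis.

Set Implicit Arguments.
Unset Strict Implicit.
Unset Printing Implicit Defensive.
Import Order.TTheory GRing.Theory Num.Theory.
Import numFieldNormedType.Exports.
Local Open Scope classical_set_scope.
Local Open Scope ring_scope.

(* Indexing: the positive integer v is encoded by v.-1, both as a value and as
   a position.  Hence p i is p_{i+1}, X i is n_{i+1}, [n] is `I_n or 'I_n, and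
   S_n is 'S_n.  The parameters k (first element of a block), l (block length)
   and n keep their usual values. *)

Section ShiftedPermutation.
Local Open Scope nat_scope.

(* N \ s has at least j.+1 elements below
   (j + size s).+1; psi s j is the one of rank j, so that psi s is the
   increasing bijection from N onto N \ s (psi_increasing, psi_range). *)
Definition psi (s : seq nat) (j : nat) : nat :=
  nth 0 [seq v <- iota 0 (j + size s).+1 | v \notin s] j.

Lemma psi_size (s : seq nat) N :
  N <= size [seq v <- iota 0 N | v \notin s] + size s.
Proof.
have -> : size [seq v <- iota 0 N | v \notin s] = count [predC s] (iota 0 N).
  by rewrite size_filter.
rewrite -[leqLHS](size_iota 0) -(count_predC (mem s)) addnC leq_add2l.
rewrite -size_filter uniq_leq_size ?filter_uniq ?iota_uniq// => v.
by rewrite mem_filter => /andP[].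
Qed.

Lemma psi_nth (s : seq nat) N j :
  j < size [seq v <- iota 0 N | v \notin s] ->
  psi s j = nth 0 [seq v <- iota 0 N | v \notin s] j.
Proof.
have aux a b : a <= b -> j < size [seq v <- iota 0 a | v \notin s] ->
    nth 0 [seq v <- iota 0 b | v \notin s] j =
    nth 0 [seq v <- iota 0 a | v \notin s] j.
  by move=> /subnKC <- h; rewrite iotaD filter_cat nth_cat h.
move=> h; rewrite /psi.
have h' : j < size [seq v <- iota 0 (j + size s).+1 | v \notin s].
  by have := psi_size s (j + size s).+1; rewrite -addSn leq_add2r.
by case: (leqP N (j + size s).+1) => [|/ltnW] le; [|symmetry]; apply: aux.
Qed.

Lemma psi_increasing (s : seq nat) : {homo psi s : i j / i < j}.
Proof.
move=> i j ij; set f := [seq v <- iota 0 (j + size s).+1 | v \notin s].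
have hj : j < size f.
  by have := psi_size s (j + size s).+1; rewrite -addSn leq_add2r.
rewrite (psi_nth (ltn_trans ij hj)) (psi_nth hj).
apply: (sorted_ltn_nth ltn_trans) => //.
  by rewrite sorted_filter ?iota_ltn_sorted//; exact: ltn_trans.
by rewrite inE (ltn_trans ij hj).
Qed.

Lemma psi_range (s : seq nat) : range (psi s) = [set v | v \notin s].
Proof.
apply/seteqP; split=> [_ [j _ <-]|v vs] /=.
  have hj : j < size [seq v <- iota 0 (j + size s).+1 | v \notin s].
    by have := psi_size s (j + size s).+1; rewrite -addSn leq_add2r.
  by have := mem_nth 0 hj; rewrite mem_filter => /andP[].
have vf : v \in [seq v <- iota 0 v.+1 | v \notin s].
  by rewrite mem_filter vs mem_iota /= ltnS.
exists (index v [seq v <- iota 0 v.+1 | v \notin s]) => //.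
by rewrite (@psi_nth s v.+1) ?nth_index ?index_mem.
Qed.

(* The first m values of the permutation built from the samples x. *)
Fixpoint shifted_prefix (x : nat -> nat) (m : nat) : seq nat :=
  if m is m'.+1 then
    rcons (shifted_prefix x m') (psi (shifted_prefix x m') (x m'))
  else [::].

(* For every x this is an injection; it is onto as soon as x takes the value 0
   infinitely often, hence almost surely for the samples considered here. *)
Definition shifted_perm (x : nat -> nat) (m : nat) : nat :=
  psi (shifted_prefix x m) (x m).

(* s = proj_n(sigma): deleting the values outside [n] from a long enough
   prefix of sigma leaves the word of s.  It fails for every s when sigma
   misses some element of [n]. *)
Definition is_proj (n : nat) (sigma : nat -> nat) (s : 'S_n) : Prop :=
  \forall N \near \oo,
    [seq v <- mkseq sigma N | v < n] = [seq val (s i) | i <- enum 'I_n].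

(* A^{(n)}_{l;k} for 2 <= l and 1 <= k <= n - l + 1. *)
Definition clustered (n l k : nat) : {set 'S_n} :=
  [set s : 'S_n | [exists m : 'I_n, (m + l <= n) &&
     ([set s i | i : 'I_n & m <= i < m + l] ==
      [set v : 'I_n | k <= v.+1 < k + l])]]%SET.

End ShiftedPermutation.

(* inf {m >= 1 : sigma([m]) = [m]}, which is +oo when the set is empty. *)
Definition first_renewal (R : realType) (sigma : nat -> nat) : \bar R :=
  ereal_inf [set m%:R%:E | m in [set m : nat |
    (0 < m)%N /\ sigma @` `I_m = `I_m]].

Section Laws.
Context d (Omega : measurableType d) (R : realType) (P : probability Omega R).
Implicit Types (X : nat -> {RV P >-> nat}) (p : nat -> R).
Local Open Scope ereal_scope.

Definition mutually_independent X : Prop :=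
  forall (I : seq nat) (E : nat -> set nat), uniq I ->
    (forall i, measurable (E i)) ->
    P (\bigcap_(i in [set` I]) X i @^-1` E i) =
    \prod_(i <- I) P (X i @^-1` E i).

Definition iid_samples X p : Prop :=
  (forall i j, distribution P (X i) [set j] = (p j)%:E) /\
  mutually_independent X.

Definition Pi X (w : Omega) : nat -> nat := shifted_perm (fun i => X i w).

(* The law P_n of proj_n(Pi) on S_n. *)
Definition proj_law X (n : nat) (A : {set 'S_n}) : \bar R :=
  P [set w | exists2 s : 'S_n, s \in A & is_proj (Pi X w) s].

Definition positive_recurrent X : Prop :=
  \int[P]_w first_renewal R (Pi X w) < +oo.

End Laws.

Definition positive_distribution (R : realType) (p : nat -> R) : Prop :=
  (forall j, 0 < p j) /\ (\sum_(0 <= j <oo) (p j)%:E = 1)%E.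

(* p_1 + ... + p_j *)
Definition psum (R : realType) (p : nat -> R) (j : nat) : R :=
  \sum_(i < j) p i.

(* The partial products lie in [0, 1] and are non-increasing, so the limit
   always exists; it may be 0. *)
Definition psum_prod (R : realType) (p : nat -> R) : R :=
  limn (fun m => \prod_(1 <= j < m) psum p j).

Definition first_moment (R : realType) (p : nat -> R) : \bar R :=
  (\sum_(0 <= j <oo) (j.+1%:R * p j)%:E)%E.

(* Main.v *)
(* Write F j = p_1 + ... + p_j.  As long as r, b and s values are missing below,
   in and above the block, the next value of [n] to appear is below, in or above
   it with probabilities proportional to F r, F (r + b) - F r and
   F (r + b + s) - F (r + b).  The probability of clustering thus solves an
   explicit recurrence in (r, s).  If a value below the block is still missing
   when the block is first hit, the block is completed without interruption with
   probability at most (1 - p_1)^(l-1); none is missing with probability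
   prod_(j <= k-1) F j / F (j + l), which is symmetric in k - 1 and l, and the
   block is then completed with probability prod_(j < l) F j / F (j + s).  Since
   p is non-increasing, s is unlikely to be small at that time, which yields
   both limits.
   The product of the F j is positive iff the sum of the 1 - F j converges, and
   that sum is the first moment.  Moreover P(Pi([m]) = [m]) = prod_(j <= m) F j,
   so decomposing at the last renewal before m gives
   sum_(j <= m) (prod_(i <= j) F i) P(T_1 > m - j) = 1, whence E T_1 is finite
   iff the infinite product is positive. *)

Require Import Defs.
From HB Require Import structures.
From mathcomp Require Import all_boot all_order all_fingroup all_algebra.
From mathcomp Require Import all_classical all_reals all_analysis.
From mathcomp Require Import zify ring lra.
Set Implicit Arguments.
Unset Strict Implicit.
Unset Printing Implicit Defensive.
Import Order.TTheory GRing.Theory Num.Theory.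
Import numFieldNormedType.Exports.
Local Open Scope classical_set_scope.
Local Open Scope ring_scope.

(** * Renewal times in terms of the samples *)

Section Unpicked.
Local Open Scope nat_scope.

Definition unpicked (s : seq nat) (M : nat) : nat :=
  size [seq v <- iota 0 M | v \notin s].

Lemma psi_notin s j : psi s j \notin s.
Proof.
have : range (psi s) (psi s j) by exists j.
by rewrite psi_range.
Qed.

(** [psi s] enumerates the complement of [s] increasingly, so comparing the picked value with [M]
    amounts to comparing the raw sample with a count. All events below are translated to the samples
    this way. *)
Lemma psi_lt s j M : (psi s j < M) = (j < unpicked s M).
Proof.
apply/idP/idP => [vM|jM]; last first.
  by have := mem_nth 0 jM; rewrite -psi_nth// mem_filter mem_iota => /andP[_].
have vf : psi s j \in [seq v <- iota 0 M | v \notin s].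
  by rewrite mem_filter psi_notin mem_iota.
have iM := vf; rewrite -index_mem in iM.
have : psi s j = psi s (index (psi s j) [seq v <- iota 0 M | v \notin s]).
  by rewrite [RHS](psi_nth iM) nth_index.
set i := index _ _ in iM * => ji.
suff -> : j = i by [].
by case: (ltngtP j i) => // /(psi_increasing s); rewrite -ji ltnn.
Qed.

Lemma unpicked_nil M : unpicked [::] M = M.
Proof. by rewrite /unpicked filter_predT size_iota. Qed.

Lemma unpicked_rcons s v M : v \notin s ->
  unpicked (rcons s v) M = unpicked s M - (v < M).
Proof.
move=> vs; rewrite /unpicked !size_filter.
have -> : count (fun x => x \notin s) (iota 0 M) =
    count (fun x => x \notin rcons s v) (iota 0 M) + count (pred1 v) (iota 0 M).
  rewrite -count_predUI [X in _ = _ + X](_ : _ = 0) ?addn0; last first.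
    rewrite (@eq_count _ _ pred0) ?count_pred0// => x /=.
    by rewrite mem_rcons inE negb_or; case: (x == v); rewrite ?andbF.
  apply: eq_count => x /=; rewrite mem_rcons inE negb_or.
  by case: eqVneq => [->|]; rewrite ?vs ?orbT ?orbF.
by rewrite count_uniq_mem ?iota_uniq// mem_iota/= addnK.
Qed.

Lemma unpicked_psi s j M :
  unpicked (rcons s (psi s j)) M = unpicked s M - (j < unpicked s M).
Proof. by rewrite unpicked_rcons ?psi_notin// psi_lt. Qed.

Lemma leq_unpicked s M N : M <= N -> unpicked s M <= unpicked s N.
Proof.
by move=> /subnKC <-; rewrite /unpicked iotaD filter_cat size_cat leq_addr.
Qed.

Lemma unpicked_size s M : uniq s ->
  unpicked s M + size [seq v <- s | v < M] = M.
Proof.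
elim/last_ind: s => [|s v IH]; first by rewrite unpicked_nil addn0.
rewrite rcons_uniq => /andP[vs us]; rewrite unpicked_rcons//.
rewrite filter_rcons -[RHS](IH us).
case: ltnP => vM; rewrite ?subn0// size_rcons addnS -addSn subn1 prednK//.
rewrite /unpicked size_filter -has_count; apply/hasP; exists v => //.
by rewrite mem_iota.
Qed.

Lemma size_shifted_prefix x m : size (shifted_prefix x m) = m.
Proof. by elim: m => //= m IH; rewrite size_rcons IH. Qed.

Lemma shifted_prefixE x m : shifted_prefix x m = mkseq (shifted_perm x) m.
Proof.
elim: m => //= m IH; rewrite -[in RHS]addn1 /mkseq iotaD map_cat /= add0n.
by rewrite cats1 -/(mkseq _ _) /shifted_perm IH.
Qed.

Lemma uniq_shifted_prefix x m : uniq (shifted_prefix x m).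
Proof. by elim: m => //= m IH; rewrite rcons_uniq psi_notin. Qed.

End Unpicked.

Section Renewal.
Local Open Scope nat_scope.

(** Renewal at [m] read off the samples: if the first [i] values lie in [m], then [m - i] of its
    values are left, and the next value lies in [m] iff [x i < m - i]. Each constraint bears on a
    single sample. *)
Definition renews (x : nat -> nat) (m : nat) : bool :=
  all (fun i => x i + i < m) (iota 0 m).

Lemma renewsP x m : reflect (forall i, i < m -> x i + i < m) (renews x m).
Proof.
apply: (iffP allP) => h i; first by move=> im; apply: h; rewrite mem_iota.
by rewrite mem_iota => /h.
Qed.

Lemma unpicked_below x m N : N <= m -> (forall i, i < N -> shifted_perm x i < m) ->
  unpicked (shifted_prefix x N) m = m - N.
Proof.
move=> Nm lt; have := unpicked_size m (uniq_shifted_prefix x N).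
rewrite (_ : [seq _ <- _ | _] = shifted_prefix x N).
  by rewrite size_shifted_prefix; lia.
apply/all_filterP/allP => v; rewrite shifted_prefixE => /mapP[i].
by rewrite mem_iota => /lt h ->.
Qed.

(** By injectivity it suffices that [m] is mapped into itself, and this is checked one position at a
    time. *)
Lemma shifted_perm_image x m : shifted_perm x @` `I_m = `I_m <-> renews x m.
Proof.
have lt_im : (forall i, i < m -> shifted_perm x i < m) <-> shifted_perm x @` `I_m = `I_m.
  split=> [lt|eq i im]; last first.
    by have : `I_m (shifted_perm x i) by rewrite -eq; exists i.
  apply/seteqP; split=> [_ [i im <-]|v vm]/=; first exact: lt.
  have : v \in shifted_prefix x m.
    have /(_ (iota 0 m)) := uniq_min_size (uniq_shifted_prefix x m).
    case.
    - move=> w; rewrite shifted_prefixE => /mapP[i].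
      by rewrite !mem_iota => /lt h ->.
    - by rewrite size_shifted_prefix size_iota.
    - by move=> _ ->; rewrite mem_iota.
  rewrite shifted_prefixE => /mapP[i]; rewrite mem_iota => im ->.
  by exists i.
rewrite -lt_im; split=> [lt|/renewsP ren].
  apply/renewsP => i im; have := lt i im; rewrite /shifted_perm psi_lt.
  by rewrite unpicked_below; [lia|lia|] => j ji; apply: lt; lia.
elim/ltn_ind => i IH im; rewrite /shifted_perm psi_lt unpicked_below.
- by have := ren i im; lia.
- lia.
- by move=> j ji; apply: IH; lia.
Qed.

End Renewal.

(** * The appearance of the block as an automaton reading the samples *)

Section Automaton.
Local Open Scope nat_scope.

Inductive phase := Before | Inside | After | Broken.

(** Reads the word that tells which successive values lie in the block. [Inside] and [After] are
    reached exactly by the words consisting of a nonempty run of [true] between two runs of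
    [false]. *)
Definition next_phase (ph : phase) (in_block : bool) : phase :=
  match ph, in_block with
  | Before, false => Before
  | (Before | Inside), true => Inside
  | (Inside | After), false => After
  | _, _ => Broken
  end.

Definition unbroken (ph : phase) : bool :=
  match ph with Inside | After => true | _ => false end.

(* [(r, b, s, ph)]: [r], [b] and [s] values are still missing below, in and
   above the block; a sample [j >= r + b + s] picks a value outside [n]. *)
Definition state : Type := (nat * nat * nat * phase)%type.

Definition step (st : state) (j : nat) : state :=
  let: (r, b, s, ph) := st in
  if j < r then (r.-1, b, s, next_phase ph false) else
  if j < r + b then (r, b.-1, s, next_phase ph true) else
  if j < r + b + s then (r, b, s.-1, next_phase ph false) else st.

Definition missing (st : state) : nat :=
  let: (r, b, s, _) := st in r + b + s.

Definition success (st : state) : bool :=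
  (missing st == 0) && unbroken st.2.

(** The automaton sees only raw samples, but its three counts locate the new value below, in or
    above the block by [psi_lt]. The projected permutation is thereby followed by a chain driven by
    the samples. *)
Lemma foldl_stepE x K l n N : K + l <= n ->
  let u := unpicked (shifted_prefix x N) in
  foldl step (K, l, n - (K + l), Before) (mkseq x N) =
  (u K, u (K + l) - u K, u n - u (K + l),
   foldl next_phase Before
     [seq K <= v < K + l | v <- shifted_prefix x N & v < n]).
Proof.
move=> Kln /=; elim: N => [|N IH].
  by rewrite /= !unpicked_nil; congr (_, _, _, _); lia.
rewrite -addn1 /mkseq iotaD map_cat /= add0n cats1 foldl_rcons -/(mkseq x N) IH.
rewrite addn1 /= !unpicked_psi filter_rcons.
have uK := leq_unpicked (shifted_prefix x N) (leq_addr l K).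
have un := leq_unpicked (shifted_prefix x N) Kln.
have [[ltK ltl] ltn] := (psi_lt (shifted_prefix x N) (x N) K,
  psi_lt (shifted_prefix x N) (x N) (K + l),
  psi_lt (shifted_prefix x N) (x N) n).
set u := psi _ _ in ltK ltl ltn *.
have geK : (K <= u) = ~~ (x N < unpicked (shifted_prefix x N) K).
  by rewrite -ltK -leqNgt.
rewrite subnKC// subnKC//.
case: ifPn => jK.
  have [jl jn] := (leq_trans jK uK, leq_trans jK (leq_trans uK un)).
  rewrite ltn jn map_rcons foldl_rcons geK ltl jK jl /=.
  by congr (_, _, _, _); lia.
case: ifPn => jl.
  have jn := leq_trans jl un.
  rewrite ltn jn map_rcons foldl_rcons geK ltl jl jK /=.
  by congr (_, _, _, _); lia.
case: ifPn => jn.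
  rewrite ltn jn map_rcons foldl_rcons geK ltl (negbTE jl) jK /=.
  by congr (_, _, _, _); lia.
by rewrite ltn (negbTE jn) /=; congr (_, _, _, _); lia.
Qed.

Definition block a b c := nseq a false ++ nseq b true ++ nseq c false.

Lemma nth_block a b c i : nth false (block a b c) i = (a <= i < a + b).
Proof.
rewrite /block !nth_cat !size_nseq !nth_nseq.
by case: ltnP => ?; [|case: ltnP => ?]; rewrite ?if_same; lia.
Qed.

Lemma count_block a b c : count id (block a b c) = b.
Proof. by rewrite /block !count_cat !count_nseq mul0n mul1n add0n addn0. Qed.

Lemma unbroken_after t :
  unbroken (foldl next_phase After t) = (t == nseq (size t) false).
Proof.
elim: t => //= -[] t IH /=; last by rewrite IH eqseq_cons.
by rewrite eqseq_cons /=; elim: t {IH}.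
Qed.

Lemma unbroken_inside t : unbroken (foldl next_phase Inside t) <->
  exists b c, t = nseq b true ++ nseq c false.
Proof.
elim: t => [|[] t IH] /=; first by split => // _; exists 0, 0.
  rewrite IH; split=> [[b [c ->]]|[[|b] [c]]]; first by exists b.+1, c.
    by case: c.
  by move=> [->]; exists b, c.
rewrite unbroken_after; split=> [/eqP ->|[[|b] [c]]//].
  by exists 0, (size t).+1.
by case: c => // c [->]; rewrite size_nseq.
Qed.

Lemma unbroken_before t : unbroken (foldl next_phase Before t) <->
  exists a b c, 0 < b /\ t = block a b c.
Proof.
elim: t => [|[] t IH] /=.
- by split=> // -[[|a]] [[|b]] [c] [].
- rewrite unbroken_inside; split=> [[b [c ->]]|[[|a] [[|b] [c []]]]//].
    by exists 0, b.+1, c.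
  by move=> _ [->]; exists b, c.
- rewrite IH; split=> [[a [b [c [b0 ->]]]]|[[|a] [b [c []]]]].
  + by exists a.+1, b, c.
  + by case: b.
  + by move=> b0 [->]; exists a, b, c.
Qed.

(** As [s] is a bijection, [bits] has exactly [l] letters [true]; if they form a single run, its
    length is [l] and its start is the required position. *)
Lemma clusteredP n l K (s : 'S_n) : 0 < l -> K + l <= n ->
  s \in clustered n l K.+1 <->
  unbroken (foldl next_phase Before
    [seq K <= v < K + l | v <- [seq val (s i) | i <- enum 'I_n]]).
Proof.
move=> l0 Kl; set bits := [seq K <= v < K + l | v <- _].
have sz : size bits = n by rewrite 2!size_map size_enum_ord.
have nthb (i : 'I_n) : nth false bits i = (K <= s i < K + l).
  rewrite (nth_map 0); last by rewrite size_map size_enum_ord.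
  by rewrite (nth_map i) ?size_enum_ord// nth_ord_enum.
have cnt : count id bits = l.
  rewrite count_map -[RHS](_ : count (fun v => K <= v < K + l) (iota 0 n) = l).
    apply/seq.permP; apply: uniq_perm; rewrite ?iota_uniq//.
      rewrite map_inj_uniq ?enum_uniq//; exact: inj_comp val_inj perm_inj.
    move=> v; rewrite mem_iota /= add0n. apply/mapP/idP => [[i _ ->]|vn].
      exact: ltn_ord.
    by exists (s^-1%g (Ordinal vn)); rewrite ?mem_enum// permKV.
  rewrite -(subnKC Kl) !iotaD !count_cat add0n.
  rewrite (@eq_in_count _ _ pred0 (iota 0 K)); last first.
    by move=> v; rewrite mem_iota/=; lia.
  rewrite (@eq_in_count _ _ predT (iota K l)); last first.
    by move=> v; rewrite mem_iota/=; lia.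
  rewrite (@eq_in_count _ _ pred0 (iota (K + l) _)); last first.
    by move=> v; rewrite mem_iota/=; lia.
  by rewrite !count_pred0 count_predT size_iota; lia.
have clE (m : nat) : ([set s i | i : 'I_n & m <= i < m + l] ==
      [set v : 'I_n | K.+1 <= v.+1 < K.+1 + l])%SET <->
    forall i : 'I_n, nth false bits i = (m <= i < m + l).
  split=> [/eqP/setP eq i|eq].
    rewrite nthb; have := eq (s i); rewrite mem_imset; last exact: perm_inj.
    by rewrite !inE => ->; lia.
  apply/eqP/setP => v; rewrite -[v](permKV s) mem_imset; last exact: perm_inj.
  by rewrite !inE -eq nthb; lia.
rewrite inE unbroken_before; split.
  move=> /existsP[m /andP[mn /clE bE]]; exists m, l, (n - (m + l)); split=> //.
  apply: (@eq_from_nth _ false); rewrite sz /block.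
    by rewrite !size_cat !size_nseq; lia.
  by move=> i ilt; rewrite -[i]/(val (Ordinal ilt)) bE nth_block.
move=> [a [b [c [b0 bE]]]].
have bl : b = l by rewrite -cnt bE count_block.
have nE : n = a + (l + c).
  by rewrite -sz bE /block !size_cat !size_nseq bl.
have an : a < n by lia.
apply/existsP; exists (Ordinal an) => /=; apply/andP; split; first by lia.
by apply/clE => i; rewrite bE nth_block bl.
Qed.

(** Clustering is decided at a finite time: once no value of [n] is missing, the projected word no
    longer changes. If some value stays missing forever, both sides fail. *)
Lemma success_proj x n l K : 0 < l -> K + l <= n ->
  (exists2 s : 'S_n, s \in clustered n l K.+1 & is_proj (shifted_perm x) s) <->
  exists N, success (foldl step (K, l, n - (K + l), Before) (mkseq x N)).
Proof.
move=> l0 Kl.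
have missingE N : missing (foldl step (K, l, n - (K + l), Before) (mkseq x N)) =
    unpicked (shifted_prefix x N) n.
  rewrite foldl_stepE//=.
  have := leq_unpicked (shifted_prefix x N) (leq_addr l K).
  by have := leq_unpicked (shifted_prefix x N) Kl; lia.
split=> [[s scl [N _ Ns]]|[N]].
  exists N; rewrite /success missingE foldl_stepE//=.
  have := Ns N (leqnn N); rewrite /= -shifted_prefixE => wE.
  have := unpicked_size n (uniq_shifted_prefix x N).
  rewrite wE size_map size_enum_ord => u0; apply/andP; split; first lia.
  exact/clusteredP.
rewrite /success missingE foldl_stepE//= => /andP[/eqP u0 unb].
have := unpicked_size n (uniq_shifted_prefix x N); rewrite u0 add0n.
set W := [seq v <- _ | _] in unb * => sW.
have uW : uniq W by rewrite filter_uniq ?uniq_shifted_prefix.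
have ltW (i : 'I_n) : nth 0 W i < n.
  have : nth 0 W i \in W by rewrite mem_nth ?sW.
  by rewrite mem_filter => /andP[].
pose f := [ffun i : 'I_n => Ordinal (ltW i)].
have finj : injective f.
  move=> i j; rewrite !ffunE => /(congr1 val)/= /eqP.
  by rewrite nth_uniq ?sW// => /eqP/val_inj.
have wE : [seq val (perm finj i) | i <- enum 'I_n] = W.
  apply: (@eq_from_nth _ 0); rewrite size_map size_enum_ord//= => i ilt.
  rewrite (nth_map (Ordinal ilt)) ?size_enum_ord// permE ffunE/=.
  by rewrite nth_enum_ord.
exists (perm finj); first by apply/clusteredP => //; rewrite wE.
(* The word already has [n] distinct entries below [n], so a longer prefix cannot add another. *)
exists N => // M /= /subnKC <-.
have := unpicked_size n (uniq_shifted_prefix x (N + (M - N))).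
rewrite wE shifted_prefixE /mkseq iotaD map_cat filter_cat.
rewrite -/(mkseq _ N) -shifted_prefixE size_cat sW.
case: [seq v <- _ | _] => [|? ?] /=; first by rewrite cats0.
lia.
Qed.

End Automaton.

(** * The recurrence for the clustering probability *)

(** The limit is the fixed point [c0 / (1 - d0)] of the limiting affine map. The distance to it is
    eventually multiplied by at most [dl], midway between [d0] and 1, up to an error tending to
    0. *)
Lemma cvg_affine_recurrence (R : realType) (u c d : nat -> R) (c0 d0 : R) :
  (forall n, u n.+1 = c n + d n * u n) ->
  c @ \oo --> c0 -> d @ \oo --> d0 -> 0 <= d0 < 1 -> cvgn u.
Proof.
move=> uS cc dc /andP[d0_ge0 d0_lt1].
have d1 : 1 - d0 != 0 by rewrite subr_eq0 eq_sym lt_eqF.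
pose L := c0 / (1 - d0).
have LE : c0 + d0 * L - L = 0 by rewrite /L; field.
apply/cvg_ex; exists L => /=; apply/cvgrPdist_le => e e0.
pose dl := (1 + d0) / 2.
have dl0 : 0 <= dl by rewrite /dl; lra.
have dl1 : dl < 1 by rewrite /dl; lra.
have ec : (fun n => c n + d n * L - L) @ \oo --> (0 : R).
  rewrite -LE; apply: cvgB; last exact: cvg_cst.
  by apply: cvgD => //; apply: cvgM => //; exact: cvg_cst.
have e'0 : 0 < e / 2 * (1 - dl) by apply: mulr_gt0; lra.
have [N1 _ N1d] : \forall n \near \oo, `|d n| <= dl.
  have dd : 0 < (1 - d0) / 2 by lra.
  move/cvgrPdist_le: dc => /(_ _ dd); apply: filterS => n dn.
  have := ler_normB d0 (d0 - d n); rewrite subKr (ger0_norm d0_ge0) /dl; lra.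
(* Errors of this size accumulate to at most [e / 2] under contraction by [dl]. *)
have [N2 _ N2e] : \forall n \near \oo, `|c n + d n * L - L| <= e / 2 * (1 - dl).
  by move/cvgr0Pnorm_le: ec; apply.
pose N := maxn N1 N2.
have bnd m : `|L - u (N + m)%N| <= dl ^+ m * `|L - u N| + e / 2.
  elim: m => [|m IH]; first by rewrite addn0 expr0 mul1r; lra.
  rewrite addnS uS (_ : L - _ = d (N + m)%N * (L - u (N + m)%N) -
    (c (N + m)%N + d (N + m)%N * L - L)); last by ring.
  rewrite (le_trans (ler_normB _ _))// normrM.
  have h1 : `|d (N + m)%N| <= dl by apply: N1d; rewrite /= /N; lia.
  have h2 : `|c (N + m)%N + d (N + m)%N * L - L| <= e / 2 * (1 - dl).
    by apply: N2e; rewrite /= /N; lia.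
  rewrite (le_trans (lerD (ler_pM _ _ h1 IH) h2))// exprS.
  lra.
have [N3 _ N3e] : \forall m \near \oo, dl ^+ m * `|L - u N| <= e / 2.
  have /cvgr0Pnorm_le : (fun m => dl ^+ m * `|L - u N|) @ \oo --> (0 : R).
    rewrite -[X in _ --> X](mul0r `|L - u N|); apply: cvgM; last exact: cvg_cst.
    by apply: cvg_expr; rewrite ger0_norm.
  have e20 : 0 < e / 2 by lra.
  by move=> /(_ _ e20); apply: filterS => m; apply: le_trans (ler_norm _).
exists (N + N3)%N => // n /= Nn.
have -> : n = (N + (n - N))%N by lia.
by rewrite (le_trans (bnd _))// -lerBrDr (le_trans (N3e _ _)) /=; [lra|lia|lra].
Qed.

Section Recurrence.
Context (R : realType) (p : nat -> R).
Hypothesis p_gt0 : forall j, 0 < p j.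
Local Notation F := (psum p).

Lemma psum0 : F 0 = 0. Proof. by rewrite /psum big_ord0. Qed.

Lemma psumS j : F j.+1 = F j + p j. Proof. by rewrite /psum big_ord_recr. Qed.

Lemma le_psum i j : (i <= j)%N -> F i <= F j.
Proof.
move=> /subnKC <-; elim: (j - i)%N => [|n IH]; first by rewrite addn0.
by rewrite addnS psumS; have := p_gt0 (i + n); lra.
Qed.

Lemma psum_sub m n : (m <= n)%N -> F n - F m = \sum_(m <= i < n) p i.
Proof.
move=> mn; rewrite /psum -!(big_mkord xpredT p).
by rewrite [in LHS](big_cat_nat (n := m))//= addrAC subrr add0r.
Qed.

Lemma psum_ge0 j : 0 <= F j. Proof. by rewrite -psum0 le_psum. Qed.

Lemma psum_gt0 j : (0 < j)%N -> 0 < F j.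
Proof. by case: j => // j _; rewrite psumS ltr_wpDl ?psum_ge0. Qed.

(* The probability that, when [r], [b] and [s] values are missing below, in and
   above the block, the [b] values are the next ones to appear. *)
Definition run_prob (b r s : nat) : R :=
  \prod_(1 <= j < b.+1) ((F (r + j) - F r) / F (r + j + s)).

(* The probability that a block of length [l] none of whose values has
   appeared will be clustered. *)
Fixpoint cluster_prob (l r : nat) : nat -> R :=
  fix aux s := ((if r is r'.+1 then F r * cluster_prob l r' s else 0) +
    (F (r + l) - F r) * run_prob l.-1 r s +
    (if s is s'.+1 then (F (r + l + s) - F (r + l)) * aux s' else 0)) /
    F (r + l + s).

Lemma run_probS b r s : (0 < r + b.+1 + s)%N ->
  F (r + b.+1 + s) * run_prob b.+1 r s = (F (r + b.+1) - F r) * run_prob b r s.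
Proof.
move=> /psum_gt0/lt0r_neq0 F0; rewrite /run_prob big_nat_recr//=.
by rewrite mulrCA [X in _ * X]mulrC divfK// mulrC.
Qed.

(** Multiplied out, the recurrence needs no case distinction: the coefficients of [r.-1] and [s.-1]
    vanish at [r = 0] and [s = 0]. *)
Lemma cluster_probE l r s : F (r + l + s) * cluster_prob l r s =
  F r * cluster_prob l r.-1 s + (F (r + l) - F r) * run_prob l.-1 r s +
  (F (r + l + s) - F (r + l)) * cluster_prob l r s.-1.
Proof.
have [/eqP|n0] := eqVneq (r + l + s)%N 0.
  rewrite !addn_eq0 => /andP[/andP[/eqP-> /eqP->] /eqP->].
  by rewrite psum0 subrr !mul0r !addr0.
have F0 : F (r + l + s) != 0 by rewrite gt_eqF ?psum_gt0 ?lt0n.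
rewrite (_ : cluster_prob l r s = ((if r is r'.+1 then F r * cluster_prob l r' s
    else 0) + (F (r + l) - F r) * run_prob l.-1 r s +
  (if s is s'.+1 then (F (r + l + s) - F (r + l)) * cluster_prob l r s'
   else 0)) / F (r + l + s)); last by case: r {n0 F0} => [|r]; case: s.
rewrite mulrC divfK//; congr (_ + _ + _).
  by case: r {n0 F0} => //; rewrite psum0 mul0r.
by case: s {n0 F0} => //; rewrite addn0 subrr mul0r.
Qed.

(** The probability that the [m] smallest missing values all appear before any of the next [s]
    ones. *)
Definition ratio_prod (m s : nat) : R := \prod_(1 <= j < m.+1) (F j / F (j + s)).

(** Both sides equal [G m * G s / G (m + s)], with [G n] the product of F 1, ..., F n. The symmetry
    turns a product whose length tends to infinity into one of fixed length. *)
Lemma ratio_prodC m s : ratio_prod m s = ratio_prod s m.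
Proof.
have nz j : F j.+1 != 0 by rewrite gt_eqF ?psum_gt0.
pose G n := \prod_(1 <= j < n.+1) F j.
have G0 n : G n != 0.
  by rewrite /G big_add1 prodf_seq_neq0; apply/allP => j _; exact: nz.
have GS n : G n.+1 = G n * F n.+1 by rewrite /G big_nat_recr.
suff main a b : ratio_prod a b = G a * G b / G (a + b)%N.
  by rewrite !main addnC [G m * _]mulrC.
rewrite /ratio_prod; elim: a => [|a IH].
  by rewrite big_geq// add0n (_ : G 0%N = 1) ?mul1r ?divff// /G big_geq.
by rewrite big_nat_recr//= IH !addSn !GS; field; rewrite !nz !G0.
Qed.

Hypothesis psum_le1 : forall j, F j <= 1.

Definition psum_prodn m : R := \prod_(1 <= j < m.+1) F j.

Lemma psum_prodn_gt0 m : 0 < psum_prodn m.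
Proof. by rewrite /psum_prodn big_add1 prodr_gt0// => j _; exact: psum_gt0. Qed.

Lemma ratio_prod_gt0 m s : 0 < ratio_prod m s.
Proof.
rewrite /ratio_prod big_add1 prodr_gt0// => j _.
by rewrite divr_gt0 ?psum_gt0// addSn.
Qed.

Lemma ratio_prod_noninc m s t : (s <= t)%N -> ratio_prod m t <= ratio_prod m s.
Proof.
move=> st; rewrite /ratio_prod !big_add1 ler_prod// => j _.
rewrite divr_ge0 ?psum_ge0//= ler_wpM2l ?psum_ge0// lef_pV2 ?posrE ?psum_gt0//.
by apply: le_psum; lia.
Qed.

Lemma psum_prodn_le_ratio m s : psum_prodn m <= ratio_prod m s.
Proof.
rewrite /ratio_prod /psum_prodn !big_add1 ler_prod// => j _.
rewrite psum_ge0/= ler_peMr ?psum_ge0// invf_ge1 ?psum_gt0//.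
Qed.

Lemma run_prob_ge0 b r s : 0 <= run_prob b r s.
Proof.
rewrite /run_prob big_add1 prodr_ge0// => j _.
by rewrite divr_ge0 ?psum_ge0// subr_ge0 le_psum// leq_addr.
Qed.

Lemma run_prob0 b s : run_prob b 0 s = ratio_prod b s.
Proof. by apply: eq_bigr => j _; rewrite psum0 subr0. Qed.

(** Each factor is at most [1 - F r / F (r + j)], hence at most [1 - F r], and [F r >= p 0] because
    a value is missing below. *)
Lemma run_prob_le b r s : (0 < r)%N -> run_prob b r s <= (1 - p 0%N) ^+ b.
Proof.
move=> r0; rewrite /run_prob.
rewrite -[b in leRHS]subn0 -(subSS 0%N b) -prodr_const_nat !big_add1.
apply: ler_prod => j _.
have F1 : F (r + j.+1) > 0 by rewrite psum_gt0// addnS.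
have F2 : F (r + j.+1 + s) > 0 by rewrite psum_gt0// addnS.
have le12 : F (r + j.+1) <= F (r + j.+1 + s) by rewrite le_psum// leq_addr.
have le01 : F r <= F (r + j.+1) by rewrite le_psum// leq_addr.
have leF1 : F (r + j.+1) <= 1 by [].
have pF : p 0%N <= F r by rewrite -[p 0%N]add0r -psum0 -psumS le_psum.
rewrite divr_ge0 ?subr_ge0//=; last exact: ltW.
rewrite ler_pdivrMr//.
have := p_gt0 0; nra.
Qed.

Lemma run_prob_le1 b r s : run_prob b r s <= 1.
Proof.
case: r => [|r]; last first.
  rewrite (le_trans (run_prob_le _ _ _))// exprn_ile1//; last first.
    by have := p_gt0 0; lra.
  by have := psum_le1 1; rewrite psumS psum0; lra.
rewrite run_prob0 (le_trans (ratio_prod_noninc _ (leq0n s)))//.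
rewrite /ratio_prod big_add1 big1// => j _.
by rewrite addn0 divff// gt_eqF ?psum_gt0.
Qed.

Lemma cluster_prob_ge0 l r s : 0 <= cluster_prob l r s.
Proof.
elim: r s => [|r IHr] s; elim: s => [|s IHs]; rewrite /= divr_ge0 ?psum_ge0//.
all: rewrite ?add0r !addr_ge0 ?mulr_ge0 ?psum_ge0 ?run_prob_ge0 ?subr_ge0 ?le_psum//.
all: lia.
Qed.

End Recurrence.

(** * Bounds on the clustering probability *)

Section Bounds.
Context (R : realType) (p : nat -> R).
Hypothesis p_gt0 : forall j, 0 < p j.
Hypothesis p_noninc : nonincreasing_seq p.
Local Notation F := (psum p).
Hypothesis psum_le1 : forall j, F j <= 1.
Local Notation run_prob := (run_prob p).
Local Notation cluster_prob := (cluster_prob p).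
Local Notation ratio_prod := (ratio_prod p).
Local Notation psum_prodn := (psum_prodn p).

(* A minimum principle for the recurrence [cluster_probE]: explicit sub- and
   supersolutions bound [cluster_prob]. *)
Lemma recurrence_ge0 l (D : nat -> nat -> R) : (0 < l)%N ->
  (forall r s, F r * D r.-1 s + (F (r + l + s) - F (r + l)) * D r s.-1 <=
    F (r + l + s) * D r s) -> forall r s, 0 <= D r s.
Proof.
move=> l0 h r s.
have F0 r' s' : 0 < F (r' + l + s') by rewrite psum_gt0//; lia.
have Fs r' s' : 0 <= F (r' + l + s') - F (r' + l).
  by rewrite subr_ge0 le_psum// leq_addr.
have prop r' s' : 0 <= F r' * D r'.-1 s' +
    (F (r' + l + s') - F (r' + l)) * D r' s'.-1 -> 0 <= D r' s'.
  by move=> /le_trans/(_ (h r' s')); rewrite pmulr_rge0.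
elim: r s => [|r IHr]; elim=> [|s IHs]; apply: prop => /=.
- by rewrite psum0 addn0 subrr !mul0r addr0.
- by rewrite psum0 mul0r add0r mulr_ge0.
- by rewrite addn0 subrr mul0r addr0 mulr_ge0 ?psum_ge0.
- by rewrite addr_ge0 ?mulr_ge0 ?psum_ge0.
Qed.

Lemma ratio_prodS r l : F r.+1 * ratio_prod r l = F (r.+1 + l) * ratio_prod r.+1 l.
Proof.
rewrite /ratio_prod [in RHS]big_nat_recr//= mulrCA [X in _ = _ * X]mulrC divfK.
  by rewrite mulrC.
by rewrite gt_eqF// psum_gt0.
Qed.

Lemma ratio_prod0 l : ratio_prod 0 l = 1.
Proof. by rewrite /ratio_prod big_geq. Qed.

(** A subsolution that keeps only the case where all values below precede the block. Its first
    factor solves the recurrence for that event, and the second bounds the subsequent run from below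
    uniformly in [s]. *)
Lemma cluster_prob_lower l r s : (0 < l)%N ->
  ratio_prod r l * psum_prodn l.-1 <= cluster_prob l r s.
Proof.
move=> l0; rewrite -subr_ge0.
apply: (recurrence_ge0 (l := l) (D := fun r s =>
  cluster_prob l r s - ratio_prod r l * psum_prodn l.-1)) => // {}r {}s; cbv beta.
rewrite !mulrBr (cluster_probE p_gt0 l r s).
have run0 := run_prob_ge0 p_gt0 l.-1 r s.
have Fr : 0 <= F (r + l) - F r by rewrite subr_ge0 le_psum// leq_addr.
case: r => [|r] in Fr run0 *.
  rewrite psum0 ratio_prod0 run_prob0.
  have := psum_prodn_le_ratio p_gt0 psum_le1 l.-1 s; rewrite psum0 in Fr; nra.
have := ratio_prodS r l; rewrite /=.
set E := psum_prodn _; set G := F (r.+1 + l).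
move=> /(congr1 (fun z => z * E)); rewrite -!mulrA => rl.
have := mulr_ge0 Fr run0; rewrite -/G; lra.
Qed.

(* The only place where the monotonicity of [p] is used: a value of the block
   is at least as likely to be picked as any single value above it. *)
Lemma above_le_block l r s : (0 < l)%N ->
  F (r + l + s) - F (r + l) <= s%:R * (F (r + l) - F r).
Proof.
case: l => // l _.
have pl : p (r + l.+1)%N <= F (r + l.+1) - F r.
  rewrite addnS psumS (le_trans (p_noninc (leqnSn _)))//.
  by rewrite lerBrDr addrC lerD2r le_psum// leq_addr.
elim: s => [|s IH]; first by rewrite addn0 subrr mul0r.
rewrite addnS psumS -natr1 mulrDl mul1r.
have : p (r + l.+1 + s)%N <= p (r + l.+1)%N by rewrite p_noninc// leq_addr.
lra.
Qed.

(* The three terms bound the cases where a value below the block is missing when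
   the block is first hit, where none is, and where at most [S] values above
   the block are still missing at that time. *)
Lemma cluster_prob_upper l r s S : (0 < l)%N -> (S <= s)%N ->
  cluster_prob l r s <= (1 - p 0%N) ^+ l.-1 +
    ratio_prod r l * ratio_prod l.-1 S + S.+1%:R / s.+1%:R.
Proof.
move=> l0 Ss.
(* [q] dominates the probability that at most [S] values above are missing when the block is first
   hit. *)
pose q s : R := if (s <= S)%N then 1 else S.+1%:R / s.+1%:R.
have -> : S.+1%:R / s.+1%:R = q s.
  rewrite /q; case: leqP => // sS; rewrite (_ : s = S) ?divff//.
  by apply/eqP; rewrite eqn_leq sS.
have c0 : 0 <= (1 - p 0%N) ^+ l.-1.
  by rewrite exprn_ge0//; have := psum_le1 1; rewrite psumS psum0; lra.
move: c0; set c : R := _ ^+ _ => c0; set G := ratio_prod l.-1 S.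
have G0 : 0 <= G by rewrite ltW// ratio_prod_gt0.
rewrite -subr_ge0.
apply: (recurrence_ge0 (l := l) (D := fun r s => c + ratio_prod r l * G + q s -
  cluster_prob l r s)) => // {Ss} {}r {}s; cbv beta.
have Fr : 0 <= F (r + l) - F r by rewrite subr_ge0 le_psum// leq_addr.
have Fs : 0 <= F (r + l + s) - F (r + l) by rewrite subr_ge0 le_psum// leq_addr.
have F0 := psum_ge0 p_gt0 r.
have ab := @above_le_block l r s l0.
(* The weight of hitting the block, restricted to [r = 0] in [X] and to [s <= S] in [Y]. These are
   the source terms matched by the second and third summands of the bound. *)
pose X : R := if r is 0%N then F (r + l) - F r else 0.
pose Y : R := if (s <= S)%N then F (r + l) - F r else 0.
have q_rec : (F (r + l + s) - F (r + l)) * q s.-1 +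
    Y <= (F (r + l + s) - F r) * q s.
  rewrite /q /Y; case: s => [|s] in ab Fs Y *; first by rewrite addn0/=; lra.
  case: (leqP s.+1 S) => sS; first by rewrite /= (ltnW sS); lra.
  rewrite addr0 /= (_ : (if (s <= S)%N then _ else _) = S.+1%:R / s.+1%:R); last first.
    case: leqP => // sS'; rewrite (_ : s = S) ?divff//; lia.
  rewrite -[in X in _ <= X](natr1 s.+1); set t := s.+1%:R in ab *.
  have t0 : 0 < t by rewrite /t ltr0Sn.
  move: ab; set A := _ - F (r + l); set B := F (r + l) - _ => ab.
  have -> : F (r + l + s.+1) - F r = A + B by rewrite /A /B; ring.
  (* Up to a nonnegative factor, the gap is the one in [above_le_block]. *)
  rewrite -subr_ge0 (_ : _ - _ = S.+1%:R / (t * (t + 1)) * (t * B - A)); last first.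
    by field; rewrite !gt_eqF//; lra.
  rewrite mulr_ge0 ?subr_ge0// divr_ge0 ?ler0n// mulr_ge0; lra.
have h_rec : F r * ratio_prod r.-1 l + X =
    F (r + l) * ratio_prod r l.
  rewrite /X; case: r {Fr Fs ab q_rec F0 Y} X => [|r] X.
    by rewrite psum0 subr0 mul0r add0r ratio_prod0 mulr1.
  by rewrite ratio_prodS addr0.
rewrite !mulrBr (cluster_probE p_gt0 l r s).
have : (F (r + l) - F r) * run_prob l.-1 r s <= (F (r + l) - F r) * c +
    X * G +
    Y.
  rewrite /X /Y; case: r => [|r] in Fr Fs F0 ab X Y q_rec h_rec *; last first.
    rewrite mul0r addr0 (le_trans (ler_wpM2l Fr (run_prob_le p_gt0 psum_le1 _ _ _)))//.
    by rewrite lerDl; case: ifP.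
  case: leqP => sS.
    have := run_prob_le1 p_gt0 psum_le1 l.-1 0 s; nra.
  have : run_prob l.-1 0 s <= G by rewrite run_prob0 ratio_prod_noninc// ltnW.
  nra.
move: (congr1 ( *%R^~ G) h_rec) => /= h_recG run_le.
clearbody X Y; clear ab Fs Fr F0 h_rec.
move: (ratio_prod _ _) (ratio_prod _ _) (cluster_prob _ _ _) (cluster_prob _ _ _)
  (run_prob _ _ _) (q _) (q _) h_recG q_rec run_le.
move: (F r) (F (r + l)) (F (r + l + s)) => x1 x2 x3 x4 x5 x6 x7 x8 x9 x10 h1 h2 h3.
clear -h1 h2 h3; clearbody c G.
lra.
Qed.

End Bounds.

(** * Limits as the number of values above the block grows *)

Section Limits.
Context (R : realType) (p : nat -> R).
Hypothesis p_gt0 : forall j, 0 < p j.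
Local Notation F := (psum p).
Hypothesis psum_cvg : F @ \oo --> (1 : R).
Local Notation run_prob := (run_prob p).
Local Notation cluster_prob := (cluster_prob p).
Local Notation ratio_prod := (ratio_prod p).
Local Notation psum_prodn := (psum_prodn p).

Lemma psum_le1 j : F j <= 1.
Proof.
rewrite -(cvg_lim (@Rhausdorff R) psum_cvg); apply: limr_ge.
  by apply/cvg_ex; exists 1.
by exists j => // n /= jn; exact: le_psum.
Qed.

Lemma psum_shift_cvg (a : nat) : (fun s => F (a + s)) @ \oo --> (1 : R).
Proof.
exact: cvg_comp (@cvg_addnl a) psum_cvg.
Qed.

Lemma ratio_prod_cvg m : ratio_prod m @ \oo --> psum_prodn m.
Proof.
rewrite /psum_prodn; apply: cvg_big; first exact: mul_continuous.
move=> j _; rewrite -[X in _ --> X]divr1.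
by apply: cvgM; [exact: cvg_cst|apply: cvgV => //; exact: psum_shift_cvg].
Qed.

Lemma run_prob_cvg b r :
  run_prob b r @ \oo --> \prod_(1 <= j < b.+1) (F (r + j) - F r).
Proof.
apply: cvg_big; first exact: mul_continuous.
move=> j _; rewrite -[X in _ --> X]divr1.
by apply: cvgM; [exact: cvg_cst|apply: cvgV => //; exact: psum_shift_cvg].
Qed.

(** For fixed [r] the recurrence is affine in [s], with slope tending to [1 - F (r + l) < 1].
    Induction on [r] provides the convergence of the inhomogeneous term. *)
Lemma cluster_prob_cvg l r : (0 < l)%N -> cvgn (cluster_prob l r).
Proof.
move=> l0.
have FS (a : nat) : (fun s => F (a + s.+1)) @ \oo --> (1 : R).
  by under eq_fun do rewrite -addSnnS; exact: psum_shift_cvg.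
have main q : cvgn (fun s => F q * cluster_prob l q.-1 s) ->
    cvgn (cluster_prob l q).
  move=> /cvg_ex[/= L prev_cvg].
  have Fn0 s : F (q + l + s) != 0 by rewrite gt_eqF// psum_gt0//; lia.
  have ltF1 : 0 <= 1 - F (q + l) < 1.
    by rewrite subr_ge0 psum_le1 ltrBlDr ltrDl psum_gt0//; lia.
  pose c s := (F q * cluster_prob l q.-1 s.+1 +
    (F (q + l) - F q) * run_prob l.-1 q s.+1) / F (q + l + s.+1).
  pose d s := (F (q + l + s.+1) - F (q + l)) / F (q + l + s.+1).
  have rec s : cluster_prob l q s.+1 = c s + d s * cluster_prob l q s.
    apply: (mulfI (Fn0 s.+1)); rewrite cluster_probE// /c /d.
    by field; exact: Fn0.
  apply: (cvg_affine_recurrence rec _ _ ltF1).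
    apply: cvgM; last by apply: cvgV; [exact: oner_neq0|exact: FS].
    apply: cvgD; first exact: cvg_comp (@cvg_addnl 1) prev_cvg.
    apply: cvgM; first exact: cvg_cst.
    exact: cvg_comp (@cvg_addnl 1) (@run_prob_cvg _ _).
  rewrite -[X in _ --> X]divr1.
  apply: cvgM; last by apply: cvgV; [exact: oner_neq0|exact: FS].
  by apply: cvgB; [exact: FS|exact: cvg_cst].
elim: r => [|r IH]; apply: main; last by apply: is_cvgM => //; exact: is_cvg_cst.
by under eq_fun do rewrite psum0 mul0r; exact: is_cvg_cst.
Qed.

End Limits.

Lemma nneseries_ltyP (R : realType) (u : nat -> R) : (forall j, 0 <= u j) ->
  (\sum_(0 <= j <oo) (u j)%:E < +oo)%E <->
  exists B, forall n, \sum_(0 <= j < n) u j <= B.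
Proof.
move=> u0; have u0' j : (0 <= j)%N -> true -> (0 <= (u j)%:E)%E.
  by rewrite lee_fin.
have s0 : (0 <= \sum_(0 <= j <oo) (u j)%:E)%E by exact: nneseries_ge0.
split=> [lty|[B uB]].
  exists (fine (\sum_(0 <= j <oo) (u j)%:E)) => n.
  by rewrite -lee_fin fineK ?ge0_fin_numE// -sumEFin; exact: nneseries_lim_ge.
apply: (@le_lt_trans _ _ B%:E); last exact: ltry.
apply: lime_le; first exact: is_cvg_nneseries.
by apply: nearW => n; rewrite sumEFin lee_fin.
Qed.

(** * The infinite product, the first moment and long blocks *)

Section ProductLimits.
Context (R : realType) (p : nat -> R).
Hypothesis p_gt0 : forall j, 0 < p j.
Hypothesis p_noninc : nonincreasing_seq p.
Local Notation F := (psum p).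
Hypothesis psum_cvg : F @ \oo --> (1 : R).
Local Notation run_prob := (run_prob p).
Local Notation cluster_prob := (cluster_prob p).
Local Notation ratio_prod := (ratio_prod p).
Local Notation psum_prodn := (psum_prodn p).
Local Notation F_le1 := (psum_le1 p_gt0 psum_cvg).

Lemma psum_prodnS m : psum_prodn m.+1 = psum_prodn m * F m.+1.
Proof. by rewrite /psum_prodn big_nat_recr. Qed.

Lemma psum_prodn_noninc : nonincreasing_seq psum_prodn.
Proof.
apply/nonincreasing_seqP => m; rewrite psum_prodnS.
by rewrite ler_piMr ?F_le1// ltW// psum_prodn_gt0.
Qed.

Lemma psum_prodn_le1 m : psum_prodn m <= 1.
Proof.
rewrite (le_trans (psum_prodn_noninc (leq0n m)))// /psum_prodn.
by rewrite big_geq.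
Qed.

Lemma psum_prodn_cvg : psum_prodn @ \oo --> psum_prod p.
Proof.
have cv : cvgn psum_prodn.
  apply: nonincreasing_is_cvgn; first exact: psum_prodn_noninc.
  by exists 0 => _ [m _ <-]; rewrite ltW// psum_prodn_gt0.
rewrite /psum_prod (_ : limn _ = limn psum_prodn) //.
apply: cvg_lim => //; rewrite -(cvg_shiftS (fun m => \prod_(1 <= j < m) F j)).
exact: cv.
Qed.

Lemma psum_prod_le m : psum_prod p <= psum_prodn m.
Proof.
rewrite -(cvg_lim (@Rhausdorff R) psum_prodn_cvg).
apply: nonincreasing_cvgn_ge; first exact: psum_prodn_noninc.
by apply/cvg_ex; exists (psum_prod p); exact: psum_prodn_cvg.
Qed.

Lemma psum_prod_ge0 : 0 <= psum_prod p.
Proof.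
rewrite -(cvg_lim (@Rhausdorff R) psum_prodn_cvg).
apply: limr_ge; first by apply/cvg_ex; exists (psum_prod p); exact: psum_prodn_cvg.
by apply: nearW => m; rewrite ltW// psum_prodn_gt0.
Qed.

Let tails M : R := \sum_(0 <= m < M) (1 - F m).

Let moment M : R := \sum_(0 <= j < M) j.+1%:R * p j.

(** Double counting: [p j] occurs in [F M - F m] for m = 0, ..., j, that is, [j.+1] times. *)
Lemma momentE M : moment M = \sum_(0 <= m < M) (F M - F m).
Proof.
elim: M => [|M IH]; first by rewrite /moment !big_geq.
rewrite /moment big_nat_recr//= -/(moment M) IH [RHS]big_nat_recr//=.
under [X in _ = X + _]eq_bigr do rewrite psumS addrAC.
rewrite [X in _ = X + _]big_split/= sumr_const_nat subn0 psumS -(natr1 M) mulrDl mul1r.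
by rewrite mulr_natl; ring.
Qed.

(** One direction uses [F M <= 1]. For the other, [M] is fixed in the sum of the [F N - F m] over
    [m < M], which is at most [moment N], and N tends to infinity. *)
Lemma moment_boundedP :
  (exists B, forall M, moment M <= B) <-> (exists B, forall M, tails M <= B).
Proof.
split=> -[B hB]; exists B => M; last first.
  apply: le_trans (hB M); rewrite momentE; apply: ler_sum => m _.
  by rewrite lerD2r F_le1.
have cv : (fun N => \sum_(0 <= m < M) (F N - F m)) @ \oo --> tails M.
  apply: cvg_big; first exact: add_continuous.
  by move=> m _; apply: cvgB; [exact: psum_cvg|exact: cvg_cst].
rewrite -(cvg_lim (@Rhausdorff R) cv); apply: limr_le.
  by apply/cvg_ex; exists (tails M).
exists M => // N /= MN; apply: le_trans (hB N); rewrite momentE.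
rewrite [leRHS](big_cat_nat (n := M))//= lerDl big_nat sumr_ge0// => m /andP[_ mN].
by rewrite subr_ge0 le_psum// ltnW.
Qed.

Lemma psum_prod_gt0P : 0 < psum_prod p <-> exists B, forall M, tails M <= B.
Proof.
have tailsS M : tails M.+1 = tails M + (1 - F M) by rewrite /tails big_nat_recr.
split=> [P0|[B tB]].
- exists (psum_prod p)^-1 => M.
  (* With F = [F m.+1], Q the old product and T the old sum, the new quantity is F (Q T) + (Q F) (1
     - F), at most F + (1 - F) = 1. *)
  have main m : psum_prodn m * tails m.+1 <= 1.
    elim: m => [|m IH].
      rewrite /psum_prodn /tails big_geq// big_nat1 psum0; lra.
    rewrite tailsS psum_prodnS mulrDr.
    have F0 := psum_ge0 p_gt0 m.+1; have F1 := F_le1 m.+1.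
    have Q1 : psum_prodn m * F m.+1 <= 1.
      by rewrite -psum_prodnS psum_prodn_le1.
    have := ler_wpM2l F0 IH; have : 0 <= 1 - F m.+1 by lra.
    by move=> /ler_wpM2r/(_ _ _ Q1); lra.
  have M0 : 0 <= tails M by apply: sumr_ge0 => m _; rewrite subr_ge0 F_le1.
  have := main M; rewrite tailsS => le1.
  rewrite -[_^-1]mul1r ler_pdivlMr// mulrC (le_trans _ le1)//.
  rewrite ler_pM ?psum_prod_ge0 ?psum_prod_le// lerDl subr_ge0.
  exact: F_le1.
- (* [F j >= exp (- (1 - F j) / p 0)], as [F j >= p 0] *)
  have main m : 1 <= psum_prodn m * expR (tails m.+1 / p 0%N).
    elim: m => [|m IH].
      rewrite /psum_prodn big_geq// mul1r -expR0 ler_expR divr_ge0 ?ltW//.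
      by rewrite /tails big_nat1 psum0; lra.
    rewrite tailsS psum_prodnS mulrDl expRD mulrACA.
    rewrite -[leLHS]mulr1 ler_pM//.
    rewrite (le_trans _ (ler_wpM2l (psum_ge0 p_gt0 _) (expR_ge1Dx _)))//.
    have pF : p 0%N <= F m.+1 by rewrite -[p 0%N]add0r -(psum0 p) -psumS le_psum.
    have -> : F m.+1 * (1 + (1 - F m.+1) / p 0%N) =
        F m.+1 + (1 - F m.+1) * (F m.+1 / p 0%N) by ring.
    have : 1 <= F m.+1 / p 0%N by rewrite ler_pdivlMr ?mul1r.
    have F1 : 0 <= 1 - F m.+1 by rewrite subr_ge0 F_le1.
    by move=> /(ler_wpM2l F1); lra.
  apply: (@lt_le_trans _ _ (expR (B / p 0%N))^-1); first by rewrite invr_gt0 expR_gt0.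
  rewrite -(cvg_lim (@Rhausdorff R) psum_prodn_cvg); apply: limr_ge.
    by apply/cvg_ex; exists (psum_prod p); exact: psum_prodn_cvg.
  apply: nearW => m; rewrite -[_^-1]mul1r ler_pdivrMr ?expR_gt0//.
  rewrite (le_trans (main m))// ler_wpM2l//; first by rewrite ltW// psum_prodn_gt0.
  by rewrite ler_expR ler_wpM2r// invr_ge0 ltW.
Qed.

Lemma first_momentP : 0 < psum_prod p <-> (first_moment p < +oo)%E.
Proof.
rewrite psum_prod_gt0P -moment_boundedP -nneseries_ltyP//.
by move=> j; rewrite mulr_ge0// ltW.
Qed.

Lemma ratio_prod_le1 m s : ratio_prod m s <= 1.
Proof.
by rewrite -run_prob0; exact: (run_prob_le1 p_gt0 F_le1).
Qed.

(** In [cluster_prob_upper], [S] is chosen first to bring [ratio_prod l.-1 S] within [e / 2] of its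
    limit, then [n] makes the last term at most [e / 2]. As [r] may vary with [n], the bound serves
    both limits of the theorem. *)
Lemma cluster_prob_eventually l (r s : nat -> nat) (e : R) : (0 < l)%N -> 0 < e ->
  s @ \oo --> \oo ->
  \forall n \near \oo, cluster_prob l (r n) (s n) <=
    (1 - p 0%N) ^+ l.-1 + ratio_prod (r n) l * psum_prodn l.-1 + e.
Proof.
move=> l0 e0 soo; have e2 : 0 < e / 2 by rewrite divr_gt0.
have [S _ /(_ S (leqnn S)) SE] : \forall S \near \oo,
    ratio_prod l.-1 S <= psum_prodn l.-1 + e / 2.
  apply: (cvgr_le (psum_prodn l.-1)); last by rewrite ltrDl.
  exact: ratio_prod_cvg.
near=> n.
have Sn : (S <= s n)%N.
  by near: n; move/cvgnyPge: soo; exact.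
rewrite (le_trans (cluster_prob_upper p_gt0 p_noninc F_le1 _ l0 Sn))//.
rewrite -!addrA lerD2l.
have Se : S.+1%:R / (s n).+1%:R <= e / 2.
  near: n.
  have /cvgr0Pnorm_le/(_ _ e2) : (fun n => S.+1%:R / (s n).+1%:R) @ \oo --> (0 : R).
    rewrite -[X in _ --> X](mulr0 S.+1%:R); apply: cvgM; first exact: cvg_cst.
    exact: cvg_comp soo cvg_harmonic.
  by apply: filterS => n; exact: le_trans (ler_norm _).
have r1 := ratio_prod_le1 (r n) l.
have r0 : 0 <= ratio_prod (r n) l by rewrite ltW// ratio_prod_gt0.
have := ler_wpM2l r0 SE; rewrite mulrDr.
have : ratio_prod (r n) l * (e / 2) <= e / 2 by rewrite ler_piMl// ltW.
by move: (S.+1%:R / _) Se => x Se; lra.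
Unshelve. all: by end_near. Qed.

Lemma p0_exp_cvg : (fun l => (1 - p 0%N) ^+ l.-1) @ \oo --> (0 : R).
Proof.
rewrite -cvg_shiftS /=; apply: cvg_expr.
have := F_le1 1; rewrite psumS psum0 => p1.
by rewrite ger0_norm; [rewrite ltrBlDr ltrDl|lra].
Qed.

Lemma psum_prodn_pred_cvg : (fun l => psum_prodn l.-1) @ \oo --> psum_prod p.
Proof. by rewrite -cvg_shiftS /=; exact: psum_prodn_cvg. Qed.

(** The lower and upper bounds differ by [(1 - p 0) ^+ l.-1], which vanishes as the block grows. *)
Lemma lim_cluster_prob r :
  (fun l => limn (cluster_prob l r)) @ \oo --> psum_prodn r * psum_prod p.
Proof.
have low : (fun l => ratio_prod r l * psum_prodn l.-1) @ \oo -->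
    psum_prodn r * psum_prod p.
  by apply: cvgM; [exact: ratio_prod_cvg|exact: psum_prodn_pred_cvg].
apply: (squeeze_cvgr _ low); last first.
  rewrite -[X in _ --> X]add0r; apply: cvgD; first exact: p0_exp_cvg.
  exact: low.
exists 1%N => // l /= l0.
have cv := cluster_prob_cvg p_gt0 psum_cvg (r := r) l0.
apply/andP; split.
  apply: limr_ge; first exact: cv.
  by apply: nearW => s; exact: (cluster_prob_lower p_gt0 F_le1).
apply/ler_addgt0Pr => e e0; apply: limr_le; first exact: cv.
by have := @cluster_prob_eventually l (fun=> r) id e l0 e0 cvg_id.
Qed.

End ProductLimits.

Lemma cvg_EFin_comp (R : realType) (u : nat -> R) (x : R) :
  u @ \oo --> x -> (EFin \o u) @ \oo --> x%:E.
Proof. by move=> ux; apply: cvg_EFin; [exact: nearW|]. Qed.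

Section LimInfSup.
Context (R : realType).
Implicit Types u v : nat -> \bar R.
Local Open Scope ereal_scope.

Lemma le_limn_einf u v : (\forall n \near \oo, u n <= v n) ->
  limn_einf u <= limn_einf v.
Proof.
move=> [N _ uv]; rewrite !limn_einf_lim; apply: lee_lim.
- exact: is_cvg_einfs.
- exact: is_cvg_einfs.
- exists N => // n /= Nn; apply: le_ereal_inf_tmp => _ [m /= nm <-].
  apply: le_trans (uv m (leq_trans Nn nm)).
  by apply: ereal_inf_lbound; exists m.
Qed.

Lemma le_limn_esup u v : (\forall n \near \oo, u n <= v n) ->
  limn_esup u <= limn_esup v.
Proof.
move=> uv; rewrite -leeN2 -!limn_einfN; apply: le_limn_einf.
by apply: filterS uv => n /=; rewrite leeN2.
Qed.

End LimInfSup.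

(** * Means over independent samples *)

Section SampleExpectation.
Context (R : realType) (p : nat -> R).
Hypothesis p_gt0 : forall j, 0 < p j.
Hypothesis p_sum1 : (\sum_(0 <= j <oo) (p j)%:E = 1)%E.
Implicit Types f g : seq nat -> \bar R.
Local Open Scope ereal_scope.

(* The expectation of [f (n_1, ..., n_N)]. *)
Fixpoint expect (N : nat) f : \bar R :=
  if N is N'.+1 then \sum_(0 <= j <oo) (p j)%:E * expect N' (fun t => f (j :: t))
  else f [::].

Let p_ge0 j : 0 <= (p j)%:E. Proof. by rewrite lee_fin ltW. Qed.

Lemma expect_ge0 N f : (forall t, 0 <= f t) -> 0 <= expect N f.
Proof.
elim: N f => [|N IH] f f0 //=; apply: nneseries_ge0 => j _ _.
by rewrite mule_ge0// IH.
Qed.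

Lemma le_expect N f g : (forall t, 0 <= f t) -> (forall t, f t <= g t) ->
  expect N f <= expect N g.
Proof.
elim: N f g => [|N IH] f g f0 fg //=; apply: lee_nneseries => j.
  by move=> _ _; rewrite mule_ge0// expect_ge0.
by move=> _; rewrite lee_wpmul2l// IH.
Qed.

Lemma expect_scale N (c : R) f : (forall t, 0 <= f t) ->
  expect N (fun t => c%:E * f t) = c%:E * expect N f.
Proof.
elim: N f => [|N IH] f f0 //=; rewrite -nneseriesZl; last first.
  by move=> j _; rewrite mule_ge0// expect_ge0.
by apply: eq_eseriesr => j _; rewrite IH// muleCA.
Qed.

Lemma expectD N f g : (forall t, 0 <= f t) -> (forall t, 0 <= g t) ->
  expect N (fun t => f t + g t) = expect N f + expect N g.
Proof.
elim: N f g => [|N IH] f g f0 g0 //=.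
rewrite -nneseriesD => [|j _ _|j _ _]; try by rewrite mule_ge0// expect_ge0.
by apply: eq_eseriesr => j _; rewrite IH// ge0_muleDr// expect_ge0.
Qed.

Lemma expect_sum N m (f : nat -> seq nat -> \bar R) : (forall i t, 0 <= f i t) ->
  expect N (fun t => \sum_(0 <= i < m) f i t) = \sum_(0 <= i < m) expect N (f i).
Proof.
elim: N f => [|N IH] f f0 //=; rewrite -nneseries_sum_nat; last first.
  by move=> i j; rewrite mule_ge0// expect_ge0.
apply: eq_eseriesr => j _; rewrite IH//.
by rewrite ge0_sume_distrr// => i _; exact: expect_ge0.
Qed.

Lemma expect1 N : expect N (fun=> 1) = 1.
Proof.
by elim: N => //= N ->; under eq_eseriesr do rewrite mule1.
Qed.

Lemma expect_pred_fin_num N (B : pred (seq nat)) :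
  expect N (fun t => (B t)%:R%:E) \is a fin_num.
Proof.
rewrite ge0_fin_numE ?expect_ge0//.
apply: (@le_lt_trans _ _ (expect N (fun=> 1))); last by rewrite expect1 ltry.
by apply: le_expect => t; rewrite lee_fin//; case: (B t).
Qed.

(** Independence of the first [M] samples from the next [N]; it will separate what precedes a
    renewal from what follows it. *)
Lemma expect_cat M N (B C : pred (seq nat)) :
  expect (M + N) (fun t => (B (take M t) && C (drop M t))%:R%:E) =
  expect M (fun t => (B t)%:R%:E) * expect N (fun t => (C t)%:R%:E).
Proof.
elim: M B => [|M IH] B.
  rewrite add0n /= -expect_scale => [|t]; last by rewrite lee_fin.
  congr expect; apply/funext => t; rewrite take0 drop0 -EFinM.
  by case: (B [::]); rewrite ?mul1r ?mul0r.
rewrite addSn /=.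
under eq_eseriesr do rewrite (IH (fun u => B (_ :: u))) muleA muleC.
rewrite -(fineK (expect_pred_fin_num N C)) nneseriesZl 1?muleC// => j _.
by rewrite mule_ge0// expect_ge0// => t; rewrite lee_fin.
Qed.

Lemma psum_cvg1 : psum p @ \oo --> (1 : R)%R.
Proof.
have : (fun n => (psum p n)%:E) @ \oo --> 1.
  rewrite -p_sum1 (_ : (fun n => _) = (fun n => \sum_(0 <= j < n) (p j)%:E)).
    by apply: is_cvg_nneseries => j _ _.
  by apply/funext => n; rewrite sumEFin big_mkord.
by move=> /fine_cvgP[].
Qed.

(** Samples beyond all missing values leave the state unchanged, so one-step means reduce to finite
    sums plus a tail of mass [1 - psum p c]. *)
Lemma eventually_cst_mean (h : nat -> R) c a : (forall j, (c <= j)%N -> h j = a) ->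
  \sum_(0 <= j <oo) (p j)%:E * (h j)%:E =
  (\sum_(0 <= j < c) p j * h j + (1 - psum p c) * a)%:E.
Proof.
move=> ha; apply/cvg_lim => //.
apply: (@cvg_trans _ ((fun n => (\sum_(0 <= j < c) p j * h j +
    (psum p n - psum p c) * a)%:E) @ \oo)).
  apply: near_eq_cvg; exists c => // n /= cn.
  under [RHS]eq_bigr do rewrite -EFinM.
  rewrite sumEFin; congr EFin; rewrite [RHS](big_cat_nat (n := c))//=.
  congr +%R; rewrite (@eq_big_nat _ _ _ c n _ (fun j => p j * a)%R); last first.
    by move=> j /andP[cj _]; rewrite ha.
  by rewrite -mulr_suml psum_sub.
apply: cvg_EFin; first exact: nearW.
apply: cvgD; first exact: cvg_cst.
apply: cvgM; last exact: cvg_cst.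
by apply: cvgB; [exact: psum_cvg1|exact: cvg_cst].
Qed.

(** The martingale property, by conditioning on the first sample. *)
Lemma expect_harmonic (T : Type) (step : T -> nat -> T) (v : T -> R) :
  (forall st, \sum_(0 <= j <oo) (p j)%:E * (v (step st j))%:E = (v st)%:E) ->
  forall N st, expect N (fun t => (v (foldl step st t))%:E) = (v st)%:E.
Proof.
move=> harm; elim=> [|N IH] st //=.
by rewrite -[RHS]harm; apply: eq_eseriesr => j _; rewrite IH.
Qed.

Lemma expect_contract (T : Type) (step : T -> nat -> T) (v : T -> R) (c : R) :
  (forall st, (0 <= v st)%R) -> (0 <= c)%R ->
  (forall st, \sum_(0 <= j <oo) (p j)%:E * (v (step st j))%:E <= (c * v st)%:E) ->
  forall N st, expect N (fun t => (v (foldl step st t))%:E) <= (c ^+ N * v st)%:E.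
Proof.
move=> v0 c0 contr; elim=> [|N IH] st /=; first by rewrite expr0 mul1r.
apply: (@le_trans _ _ (\sum_(0 <= j <oo) (c ^+ N)%:E * ((p j)%:E * (v (step st j))%:E))).
  apply: lee_nneseries => j.
    by move=> _ _; rewrite mule_ge0// expect_ge0// => t; rewrite lee_fin.
  by move=> _; rewrite muleCA lee_wpmul2l// -EFinM IH.
rewrite nneseriesZl; last by move=> j _; rewrite mule_ge0// lee_fin.
rewrite exprSr -mulrA EFinM lee_wpmul2l// lee_fin exprn_ge0//.
Qed.

End SampleExpectation.

(** * The law of finite words of samples *)

Section Samples.
Context d (Omega : measurableType d) (R : realType) (P : probability Omega R).
Context (X : nat -> {RV P >-> nat}) (p : nat -> R).
Hypothesis p_gt0 : forall j, 0 < p j.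
Hypothesis X_iid : iid_samples X p.
Local Open Scope ereal_scope.

Definition samples M N (w : Omega) : seq nat := [seq X i w | i <- iota M N].

Lemma samplesS M N w : samples M N.+1 w = rcons (samples M N w) (X (M + N) w).
Proof. by rewrite /samples -addn1 iotaD map_cat cats1. Qed.

Lemma samples_eqE N t : size t = N ->
  [set w | samples 0 N w = t] =
  \bigcap_(i in [set` iota 0 N]) X i @^-1` [set nth 0%N t i].
Proof.
move=> tN; apply/seteqP; split=> w /= => [<- i|h].
  rewrite /= mem_iota => /andP[_ iN].
  by rewrite /samples (nth_map 0%N) ?size_iota// nth_iota.
apply: (@eq_from_nth _ 0%N); rewrite size_map size_iota// => i iN.
rewrite (nth_map 0%N) ?size_iota// nth_iota//; apply: h.
by rewrite /= mem_iota.
Qed.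

(** There are countably many finite words, so the event is a countable union of cylinders. *)
Lemma measurable_samples N (Q : set (seq nat)) :
  measurable [set w | Q (samples 0 N w)].
Proof.
have -> : [set w | Q (samples 0 N w)] =
    \bigcup_(t : seq nat) ([set w | samples 0 N w = t] `&` [set _ | Q t]).
  by apply/seteqP; split=> [w Qw|w [t _ /= [<-]]]//; exists (samples 0 N w).
apply: countable_bigcupT_measurable => // t.
apply: measurableI; last first.
  have [Qt|nQt] := pselect (Q t).
    by rewrite (_ : [set _ | _] = setT)//; apply/seteqP; split.
  by rewrite (_ : [set _ | _] = set0)//; apply/seteqP; split.
have [tN|/eqP tN] := eqVneq (size t) N; last first.
  rewrite (_ : [set _ | _] = set0)//; apply/seteqP; split=> // w /= wt.
  by apply: tN; rewrite -wt size_map size_iota.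
rewrite samples_eqE//; apply: bigcap_measurableType => i _.
by rewrite -[X in measurable X]setTI; apply: measurable_funPT.
Qed.

Lemma prob_samples_eq t :
  P [set w | samples 0 (size t) w = t] = (\prod_(j <- t) p j)%:E.
Proof.
have [law indep] := X_iid.
rewrite samples_eqE// indep ?iota_uniq//.
rewrite (big_nth 0%N) -prodEFin /index_iota subn0; apply: eq_bigr => i _.
exact: law.
Qed.

(** The fixed prefix [t] makes the induction work: the event is split according to the next sample,
    which is moved to the end of [t]. *)
Lemma prob_samples_split t N (B : pred (seq nat)) :
  P [set w | samples 0 (size t) w = t /\ B (samples (size t) N w)] =
  (\prod_(j <- t) p j)%:E * expect p N (fun u => (B u)%:R%:E).
Proof.
elim: N t B => [|N IH] t B /=.
  rewrite /samples /=; case: (B [::]); last first.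
    by rewrite mule0 (_ : [set _ | _] = set0) ?measure0//; apply/seteqP; split=> // w [].
  rewrite mule1 -prob_samples_eq; congr (P _).
  by apply/seteqP; split=> w /= => [[]|].
have -> : [set w | samples 0 (size t) w = t /\ B (samples (size t) N.+1 w)] =
    \bigcup_j [set w | samples 0 (size (rcons t j)) w = rcons t j /\
                       B (j :: samples (size (rcons t j)) N w)].
  apply/seteqP; split=> [w [wt Bw]|w [j _]] /=.
    exists (X (size t) w) => //=; rewrite size_rcons; split=> //.
    by rewrite -{2}wt samplesS.
  rewrite size_rcons samplesS => -[].
  move=> /eqP; rewrite eqseq_rcons => /andP[/eqP wt /eqP jw] Bw.
  by split=> //; rewrite -jw in Bw.
rewrite measure_semi_bigcup.
- rewrite (eq_eseriesr (fun j _ => IH (rcons t j) (fun u => B (j :: u)))).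
  rewrite -nneseriesZl; last first.
    by move=> j _; apply: mule_ge0; [rewrite lee_fin ltW|exact: expect_ge0].
  by apply: eq_eseriesr => j _; rewrite -cats1 big_cat big_seq1 EFinM muleA.
- move=> j; pose Q u := take (size (rcons t j)) u = rcons t j /\
    B (j :: drop (size (rcons t j)) u).
  rewrite (_ : [set _ | _] = [set w | Q (samples 0 (size (rcons t j) + N) w)]).
    exact: measurable_samples.
  apply/seteqP; split=> w; rewrite /Q /samples /= iotaD map_cat add0n.
    by rewrite take_size_cat ?drop_size_cat// size_map size_iota.
  by rewrite take_size_cat ?drop_size_cat// size_map size_iota.
- apply/trivIsetP => i j _ _ ij; apply/seteqP; split=> // w /= [[wi _] [wj _]].
  move: wi wj; rewrite !size_rcons => -> /eqP; rewrite eqseq_rcons => /andP[_ /eqP].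
  by move/eqP: ij.
- pose Q u := exists j, take (size (rcons t j)) u = rcons t j /\
    B (j :: drop (size (rcons t j)) u).
  rewrite (_ : \bigcup_j _ = [set w | Q (samples 0 ((size t).+1 + N) w)]).
    exact: measurable_samples.
  apply/seteqP; split=> w; rewrite /Q /samples /=;
    rewrite -[_ :: _]/(map _ (iota 0 (_.+1 + _))) iotaD map_cat add0n.
    move=> [j _ [wj Bw]]; exists j.
    by move: wj Bw; rewrite !size_rcons take_size_cat ?drop_size_cat// size_map size_iota.
  move=> [j h]; exists j => //; move: h.
  by rewrite !size_rcons take_size_cat ?drop_size_cat// size_map size_iota.
Qed.

Lemma prob_samples N (B : pred (seq nat)) :
  P [set w | B (samples 0 N w)] = expect p N (fun u => (B u)%:R%:E).
Proof.
have := prob_samples_split [::] N B; rewrite /= big_nil mul1e => <-.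
by congr (P _); apply/seteqP; split=> w //= [].
Qed.

End Samples.

(** * The law of the projected permutation *)

Section ClusterLaw.
Context (R : realType) (p : nat -> R).
Hypothesis p_gt0 : forall j, 0 < p j.
Hypothesis p_sum1 : (\sum_(0 <= j <oo) (p j)%:E = 1)%E.
Local Notation F := (psum p).
Local Notation F_le1 := (psum_le1 p_gt0 (psum_cvg1 p_gt0 p_sum1)).

(** The recurrence averages quantities at most 1, with weights adding up to [F (r + l + s)]. If
    nothing is missing the numerator is 0. *)
Lemma cluster_prob_le1 l r s : cluster_prob p l r s <= 1.
Proof.
have step r' s' : (0 < r' + l + s')%N ->
    F r' * cluster_prob p l r'.-1 s' +
    (F (r' + l + s') - F (r' + l)) * cluster_prob p l r' s'.-1 <=
    F r' + (F (r' + l + s') - F (r' + l)) -> cluster_prob p l r' s' <= 1.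
  move=> /(psum_gt0 p_gt0) F0 h; rewrite -(ler_pM2l F0) cluster_probE// mulr1.
  have Fr : 0 <= F (r' + l) - F r' by rewrite subr_ge0 le_psum// leq_addr.
  have := ler_wpM2l Fr (run_prob_le1 p_gt0 F_le1 l.-1 r' s'); rewrite mulr1.
  move: h; lra.
have Fs r' s' : 0 <= F (r' + l + s') - F (r' + l).
  by rewrite subr_ge0 le_psum// leq_addr.
elim: r s => [|r IHr]; elim=> [|s IHs].
- case: l step Fs => [|l] step Fs.
    by rewrite /= psum0 subrr !mul0r addr0 add0r mul0r.
  by apply: step => //=; rewrite addn0 subrr psum0 !mul0r.
- apply: step; first by lia.
  by rewrite psum0 mul0r !add0r /= ler_piMr.
- apply: step; first by lia.
  by rewrite addn0 subrr mul0r !addr0 /= ler_piMr// psum_ge0.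
- apply: step; first by lia.
  by apply: lerD; rewrite ler_piMr// psum_ge0.
Qed.

Lemma step_mean (v : state -> R) (r b s : nat) (ph : phase) :
  (\sum_(0 <= j <oo) (p j)%:E * (v (step (r, b, s, ph) j))%:E =
  (F r * v (r.-1, b, s, next_phase ph false) +
   (F (r + b) - F r) * v (r, b.-1, s, next_phase ph true) +
   (F (r + b + s) - F (r + b)) * v (r, b, s.-1, next_phase ph false) +
   (1 - F (r + b + s)) * v (r, b, s, ph))%:E)%E.
Proof.
rewrite (eventually_cst_mean p_gt0 p_sum1 (c := (r + b + s)%N) (a := v (r, b, s, ph))).
  have part m n (h : nat -> R) (x : R) : (m <= n)%N ->
      (forall j, (m <= j < n)%N -> h j = x) ->
      \sum_(m <= j < n) p j * h j = (F n - F m) * x.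
    move=> mn hx; rewrite (@eq_big_nat _ _ _ m n _ (fun j => p j * x)); last first.
      by move=> j mj; rewrite hx.
    by rewrite -mulr_suml psum_sub.
  congr EFin; congr +%R.
  rewrite (big_cat_nat (n := (r + b)%N)) ?leq_addr//= (big_cat_nat (n := r)) ?leq_addr//=.
  congr (_ + _ + _).
  - rewrite (@part 0%N r _ (v (r.-1, b, s, next_phase ph false)))// ?psum0 ?subr0//.
    by move=> j /andP[_ jr]; rewrite /step jr.
  - apply: part => [|j /andP[rj jb]]; first by rewrite leq_addr.
    by rewrite /step ltnNge rj /= jb.
  - apply: part => [|j /andP[rj jb]]; first by rewrite leq_addr.
    by rewrite /step ltnNge (leq_trans _ rj) ?leq_addr//= ltnNge rj /= jb.
move=> j js; rewrite /step !ifF//; lia.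
Qed.

(** The candidate for the probability of eventual success from each state, identified below by being
    harmonic and by its values once nothing is missing. *)
Definition success_prob (st : state) : R :=
  let: (r, b, s, ph) := st in
  match ph with
  | Before => cluster_prob p b r s
  | Inside => run_prob p b r s
  | After => (b == 0)%N%:R
  | Broken => 0
  end.

Lemma success_prob_harmonic st :
  (\sum_(0 <= j <oo) (p j)%:E * (success_prob (step st j))%:E =
   (success_prob st)%:E)%E.
Proof.
case: st => [[[r b] s] ph]; rewrite step_mean; congr EFin.
case: ph => /=.
- by have := cluster_probE p_gt0 b r s; lra.
- case: b => [|b] /=.
    by rewrite !addn0 subrr mul0r /run_prob big_geq//; lra.
  have tot0 : (0 < r + b.+1 + s)%N by lia.
  by have := run_probS p_gt0 tot0; lra.
- by rewrite mulr0; case: b => [|b] /=; rewrite ?addn0; lra.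
- by rewrite !mulr0 !addr0.
Qed.

(* Decays geometrically in mean, so that almost surely no value stays missing. *)
Definition potential (st : state) : R :=
  if missing st == 0%N then 0 else 2 ^+ missing st.

(** While something is missing, a sample picks a missing value of [n] with probability at least
    [p 0], and this at least halves the potential. *)
Lemma potential_contract st :
  (\sum_(0 <= j <oo) (p j)%:E * (potential (step st j))%:E <=
   ((1 - p 0%N / 2) * potential st)%:E)%E.
Proof.
case: st => [[[r b] s] ph]; rewrite step_mean lee_fin.
have pot_le r' b' s' ph' : potential (r', b', s', ph') <= 2 ^+ (r' + b' + s').
  by rewrite /potential; case: ifP => _ //; rewrite exprn_ge0.
have [/eqP|tot0] := eqVneq (r + b + s)%N 0%N.
  rewrite !addn_eq0 => /andP[/andP[/eqP-> /eqP->] /eqP->].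
  by rewrite /potential/= psum0 subrr !mul0r !mulr0 !addr0.
have -> : potential (r, b, s, ph) = 2 ^+ (r + b + s) by rewrite /potential ifN.
set V := 2 ^+ _.
have V0 : 0 <= V by rewrite exprn_ge0.
have half r' b' s' ph' : (r' + b' + s').+1 = (r + b + s)%N ->
    potential (r', b', s', ph') <= V / 2.
  move=> tE; rewrite (le_trans (pot_le _ _ _ _))// /V -tE exprSr mulfK//.
have Frb : 0 <= F (r + b) - F r by rewrite subr_ge0 le_psum// leq_addr.
have Fs : 0 <= F (r + b + s) - F (r + b) by rewrite subr_ge0 le_psum// leq_addr.
have below : F r * potential (r.-1, b, s, next_phase ph false) <= F r * (V / 2).
  case: r {pot_le tot0 Frb Fs} @V V0 half => [|r] V V0 half.
    by rewrite psum0 !mul0r.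
  by rewrite ler_wpM2l ?psum_ge0// half.
have inside : (F (r + b) - F r) * potential (r, b.-1, s, next_phase ph true) <=
    (F (r + b) - F r) * (V / 2).
  case: b {pot_le tot0 Fs below} @V V0 half Frb => [|b] V V0 half Frb.
    by rewrite addn0 subrr !mul0r.
  by rewrite ler_wpM2l// half//; lia.
have above : (F (r + b + s) - F (r + b)) * potential (r, b, s.-1, next_phase ph false) <=
    (F (r + b + s) - F (r + b)) * (V / 2).
  case: s {pot_le tot0 Frb below inside} @V V0 half Fs => [|s] V V0 half Fs.
    by rewrite addn0 subrr !mul0r.
  by rewrite ler_wpM2l// half//; lia.
have pF : p 0%N <= F (r + b + s).
  by rewrite -[p 0%N]add0r -(psum0 p) -psumS le_psum// lt0n.
have := ler_wpM2r V0 pF; move: below inside above.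
clearbody V; lra.
Qed.

End ClusterLaw.

Section ProjLaw.
Context d (Omega : measurableType d) (R : realType) (P : probability Omega R).
Context (X : nat -> {RV P >-> nat}) (p : nat -> R).
Hypothesis p_gt0 : forall j, 0 < p j.
Hypothesis p_sum1 : (\sum_(0 <= j <oo) (p j)%:E = 1)%E.
Hypothesis X_iid : iid_samples X p.
Local Open Scope ereal_scope.

(** The mean of [v] is conserved, and [ind <= v <= ind + potential]. The mean of the potential tends
    to 0, so the probabilities of the increasing events [S N] tend to [v st0]. *)
Lemma proj_law_clustered n l K : (0 < l)%N -> (K + l <= n)%N ->
  proj_law X (clustered n l K.+1) = (cluster_prob p l K (n - (K + l)))%:E.
Proof.
move=> l0 Kl; set st0 : state := (K, l, (n - (K + l))%N, Before).
pose S N := [set w | success (foldl step st0 (samples X 0 N w))].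
have SE : [set w | exists2 s : 'S_n, s \in clustered n l K.+1 & is_proj (Pi X w) s] =
    \bigcup_N S N.
  apply/seteqP; split=> w.
    by move=> /(success_proj _ l0 Kl)[N SN]; exists N.
  by move=> [N _ SN]; apply/(success_proj _ l0 Kl); exists N.
have mS N : measurable (S N).
  exact: (measurable_samples X N (fun t => success (foldl step st0 t))).
(* Success is absorbing: with nothing missing, [step] fixes the state. *)
have S_incr : {homo S : n m / (n <= m)%N >-> (n <= m)%O}.
  apply/nondecreasing_seqP => N; apply/subsetPset => w.
  rewrite /S /mkset samplesS foldl_rcons.
  case: (foldl _ _ _) => [[[r b] s] ph]; rewrite /success /= => /andP[m0 unb].
  by move: m0; rewrite !addn_eq0 => /andP[/andP[/eqP-> /eqP->] /eqP->]/=.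
have S_cvg : (P \o S) @ \oo --> P (\bigcup_N S N).
  by apply: nondecreasing_cvg_mu => //; exact: bigcup_measurable.
pose v := success_prob p; pose ind st : R := (success st)%:R.
have v_ge0 st : (0 <= v st)%R.
  case: st => [[[r b] s] []] //=; [exact: cluster_prob_ge0|exact: run_prob_ge0].
have ind_v st : (ind st <= v st)%R.
  rewrite /ind; have [|_]//= := boolP (success st).
  case: st => [[[r b] s] ph] /andP[/=]; rewrite !addn_eq0.
  move=> /andP[/andP[/eqP-> /eqP->] /eqP->].
  by case: ph => //= _; rewrite /run_prob big_geq.
(* Once nothing is missing [v] agrees with [ind]; before that, [v <= 1] and the potential is at
   least 1. *)
have v_ind st : (v st <= ind st + potential R st)%R.
  rewrite /potential; case: eqVneq => [m0|m0]; last first.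
    rewrite (@le_trans _ _ 1%R)//; last by rewrite ler_wpDl ?ler0n// exprn_ege1// ler1n.
    case: st {m0} => [[[r b] s] []] //=.
    + exact: cluster_prob_le1.
    + exact: (run_prob_le1 p_gt0 (psum_le1 p_gt0 (psum_cvg1 p_gt0 p_sum1))).
    + by case: (b == 0%N).
  rewrite addr0; case: st m0 => [[[r b] s] ph] m0; rewrite /ind /success m0 eqxx /=.
  move/eqP: m0; rewrite /= !addn_eq0 => /andP[/andP[/eqP-> /eqP->] /eqP->].
  case: ph => //=; first by rewrite psum0 subrr !mul0r !addr0 mul0r.
  by rewrite /run_prob big_geq.
have PS N : P (S N) = expect p N (fun t => (ind (foldl step st0 t))%:E).
  exact: (prob_samples p_gt0 X_iid N (fun t => success (foldl step st0 t))).
have harm := expect_harmonic (success_prob_harmonic p_gt0 p_sum1).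
rewrite /proj_law SE -(cvg_lim (@ereal_hausdorff R) S_cvg).
have cv : cvgn (P \o S) by apply/cvg_ex; exists (P (\bigcup_N S N)).
apply/eqP; rewrite eq_le; apply/andP; split.
  apply: lime_le => //; apply: nearW => N /=; rewrite PS.
  rewrite -(harm N st0); apply: le_expect => // t.
    by rewrite lee_fin ler0n.
  by rewrite lee_fin; exact: ind_v.
pose c : R := (1 - p 0%N / 2)%R.
have p01 : (p 0%N <= 1)%R.
  have := psum_le1 p_gt0 (psum_cvg1 p_gt0 p_sum1) 1; by rewrite psumS psum0 add0r.
have p00 := p_gt0 0.
have bound N : (v st0)%:E <= P (S N) + (c ^+ N * potential R st0)%:E.
  rewrite PS -(harm N st0).
  apply: (@le_trans _ _ (expect p N (fun t => (ind (foldl step st0 t))%:E +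
      (potential R (foldl step st0 t))%:E))).
    apply: le_expect => // t; first by rewrite lee_fin.
    by rewrite -EFinD lee_fin; exact: v_ind.
  have pot0 st : (0 <= potential R st)%R.
    by rewrite /potential; case: ifP => // _; rewrite exprn_ge0.
  rewrite expectD//; try by move=> t; rewrite lee_fin ?ler0n.
  apply: leeD => //; apply: expect_contract => //; first by rewrite /c; lra.
  exact: (potential_contract p_gt0 p_sum1).
apply/lee_addgt0Pr => e e0.
have /cvgr0Pnorm_le/(_ _ e0)[N _ /(_ N (leqnn N)) Ne] :
    (fun N => c ^+ N * potential R st0)%R @ \oo --> (0 : R)%R.
  rewrite -[X in _ --> X](mul0r (potential R st0)); apply: cvgM; last exact: cvg_cst.
  by apply: cvg_expr; rewrite /c ger0_norm; lra.
apply: (le_trans (bound N)); apply: leeD.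
  rewrite (cvg_lim (@ereal_hausdorff R) S_cvg) le_measure ?inE//.
    exact: bigcup_measurable.
  by apply: bigcup_sup.
by rewrite lee_fin (le_trans (ler_norm _)).
Qed.

End ProjLaw.

(** * Renewal theory *)

Section NoRenewal.
Local Open Scope nat_scope.
Implicit Types x y : nat -> nat.

Lemma eq_renews x y m : (forall i, i < m -> x i = y i) -> renews x m = renews y m.
Proof.
by move=> xy; apply: eq_in_all => i; rewrite mem_iota => /andP[_ /xy ->].
Qed.

Definition no_renewal x (m : nat) : bool :=
  all (fun i => ~~ renews x i.+1) (iota 0 m).

Lemma no_renewalP x m :
  reflect (forall i, 0 < i <= m -> ~~ renews x i) (no_renewal x m).
Proof.
apply: (iffP allP) => h i.
  by case: i => // i im; apply: h; rewrite mem_iota.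
by rewrite mem_iota => /andP[_ im]; apply: h.
Qed.

Lemma no_renewalS x m : no_renewal x m.+1 = no_renewal x m && ~~ renews x m.+1.
Proof. by rewrite /no_renewal -addn1 iotaD all_cat /= andbT addn1. Qed.

Lemma eq_no_renewal x y m : (forall i, i < m -> x i = y i) ->
  no_renewal x m = no_renewal y m.
Proof.
move=> xy; apply: eq_in_all => i; rewrite mem_iota => /andP[_ im].
by rewrite (@eq_renews x y)// => j ji; apply: xy; lia.
Qed.

(** After a renewal the samples start afresh: the constraints before [j] hold already, and the later
    ones are shifted by [j]. *)
Lemma renews_shift x j m : renews x j ->
  renews (fun i => x (j + i)) m = renews x (j + m).
Proof.
move=> /renewsP rj; apply/renewsP/renewsP => h i im; last first.
  by have := h (j + i); lia.
have [ij|ij] := ltnP i j; first by have := rj i ij; lia.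
by have := h (i - j); rewrite subnKC//; lia.
Qed.

(* Exactly one [j <= m] is the last renewal time before [m]. *)
Lemma last_renewal_unique x m :
  \sum_(0 <= j < m.+1) (renews x j && no_renewal (fun i => x (j + i)) (m - j)) = 1.
Proof.
elim: m => [|m IH]; first by rewrite big_nat1.
rewrite big_nat_recr//= subnn andbT.
rewrite (@eq_big_nat _ _ _ 0 m.+1 _ (fun j => (renews x j &&
    no_renewal (fun i => x (j + i)) (m - j)) * ~~ renews x m.+1)).
  by rewrite -big_distrl /= IH; case: renews.
move=> j /andP[_ jm]; rewrite subSn// no_renewalS mulnb andbA.
have [rj|//] := boolP (renews x j); rewrite renews_shift//.
by rewrite (_ : j + (m - j).+1 = m.+1)//; lia.
Qed.

End NoRenewal.

Section RenewalEquation.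
Context (R : realType) (p : nat -> R).
Hypothesis p_gt0 : forall j, 0 < p j.
Hypothesis p_sum1 : (\sum_(0 <= j <oo) (p j)%:E = 1)%E.
Local Notation psum_prodn := (psum_prodn p).
Local Notation F_cvg := (psum_cvg1 p_gt0 p_sum1).

(** The first sample must be below [m.+1], an event of probability F (m + 1), and the remaining ones
    must renew at [m]. *)
Lemma expect_renews m :
  expect p m (fun t => (renews (nth 0%N t) m)%:R%:E) = (psum_prodn m)%:E.
Proof.
elim: m => [|m IH]; first by rewrite /= /psum_prodn big_geq.
have renS j t : renews (nth 0%N (j :: t)) m.+1 = (j < m.+1)%N && renews (nth 0%N t) m.
  apply/renewsP/andP => [h|[jm /renewsP h] [_|i im]] /=.
  - split; first by have := h 0%N isT; rewrite addn0.
    by apply/renewsP => i im; have := h i.+1 im; rewrite /=; lia.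
  - by rewrite addn0.
  - by have := h i im; lia.
rewrite /= (eq_eseriesr (g := fun j =>
    ((p j)%:E * (psum_prodn m * (j < m.+1)%N%:R)%:E)%E)); last first.
  move=> j _; congr (_ * _)%E; rewrite mulrC EFinM -IH -expect_scale//.
  by congr (expect p _ _); apply/funext => t; rewrite renS -EFinM -natrM mulnb.
rewrite (eventually_cst_mean p_gt0 p_sum1 (c := m.+1) (a := 0)); last first.
  by move=> j mj; rewrite ltnNge mj mulr0.
rewrite mulr0 addr0 psum_prodnS; congr EFin.
rewrite (@eq_big_nat _ _ _ 0%N m.+1 _ (fun j => p j * psum_prodn m)); last first.
  by move=> j /andP[_ ->]; rewrite mulr1.
by rewrite -mulr_suml mulrC /psum big_mkord.
Qed.

(* [no_renewal_prob m] is the probability that [T_1 > m]. *)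
Definition no_renewal_prob (m : nat) : R :=
  fine (expect p m (fun t => (no_renewal (nth 0%N t) m)%:R%:E)).

Lemma no_renewal_prob_ge0 m : 0 <= no_renewal_prob m.
Proof.
by rewrite fine_ge0// expect_ge0// => t; rewrite lee_fin ler0n.
Qed.

Lemma renewal_equation m :
  \sum_(0 <= j < m.+1) psum_prodn j * no_renewal_prob (m - j) = 1.
Proof.
apply: EFin_inj; rewrite -sumEFin -(expect1 p_sum1 m).
transitivity (expect p m (fun t => \sum_(0 <= j < m.+1)
    (renews (nth 0%N t) j &&
     no_renewal (nth 0%N (drop j t)) (m - j))%:R%:E)%E); last first.
  congr (expect p _ _); apply/funext => t; rewrite sumEFin -natr_sum.
  rewrite -[X in _ = X]/(1%N%:R%:E) -(last_renewal_unique (nth 0%N t) m).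
  congr (_%:R%:E); apply: eq_bigr => j _; congr (nat_of_bool (_ && _)).
  by apply: eq_no_renewal => i _; rewrite nth_drop.
rewrite expect_sum//.
rewrite big_nat [RHS]big_nat; apply: eq_bigr => j /andP[_ jm].
rewrite EFinM -expect_renews /no_renewal_prob fineK ?expect_pred_fin_num//.
rewrite -expect_cat// subnKC//; congr (expect p _ _); apply/funext => t.
congr (_%:R%:E); congr (_ && _).
by apply: eq_renews => i ij; rewrite nth_take.
Qed.

(** If the product is positive, it bounds every [psum_prodn] in the renewal equation from below, so
    the partial sums are at most its inverse. The converse passes to the limit in [bound]. *)
Lemma psum_prod_gt0_renewal :
  0 < psum_prod p <-> exists B, forall n, \sum_(0 <= i < n) no_renewal_prob i <= B.
Proof.
pose T n := \sum_(0 <= i < n) no_renewal_prob i.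
have T_nd : nondecreasing_seq T.
  by apply/nondecreasing_seqP => n; rewrite /T big_nat_recr//= lerDl no_renewal_prob_ge0.
have reindex m : 1 = \sum_(0 <= i < m.+1) psum_prodn (m - i) * no_renewal_prob i.
  rewrite -(renewal_equation m) [RHS]big_nat_rev/=; apply: eq_big_nat => j /andP[_ jm].
  by rewrite add0n subSS subKn.
split=> [P0|[B hB]].
  exists (psum_prod p)^-1 => n; apply: (le_trans (T_nd _ _ (leqnSn n))).
  rewrite -[_^-1]mul1r ler_pdivlMr// (reindex n) /T mulr_suml.
  apply: ler_sum => i _; rewrite mulrC ler_wpM2r ?no_renewal_prob_ge0//.
  exact: (psum_prod_le p_gt0 F_cvg).
have T_cvg : cvgn T.
  by apply: nondecreasing_is_cvgn => //; exists B => _ [n _ <-]; exact: hB.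
have T_le n : T n <= limn T by exact: nondecreasing_cvgn_le.
have T_ge0 n : 0 <= T n by apply: sumr_ge0 => i _; exact: no_renewal_prob_ge0.
(* The equation at 2N is split at N: the factors [psum_prodn] are at most 1 for i >= N, and at most
   [psum_prodn N] for i < N. *)
have bound N : 1 <= (limn T - T N) + psum_prodn N * limn T.
  rewrite (reindex (N + N)%N) (big_cat_nat (n := N))//=; last by lia.
  rewrite addrC; apply: lerD.
    apply: (@le_trans _ _ (T (N + N).+1 - T N)); last by rewrite lerD2r.
    have -> : T (N + N).+1 - T N = \sum_(N <= i < (N + N).+1) no_renewal_prob i.
      apply/eqP; rewrite subr_eq addrC; apply/eqP; rewrite /T.
      by apply: big_cat_nat => //; lia.
    apply: ler_sum => i _.
    by rewrite ler_piMl ?no_renewal_prob_ge0// (psum_prodn_le1 p_gt0 F_cvg).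
  apply: (@le_trans _ _ (psum_prodn N * T N)); last first.
    by rewrite ler_wpM2l// ltW// psum_prodn_gt0.
  rewrite /T mulr_sumr big_nat [leRHS]big_nat; apply: ler_sum => i /andP[_ iN].
  rewrite ler_wpM2r ?no_renewal_prob_ge0//.
  by apply: (psum_prodn_noninc p_gt0 F_cvg); lia.
have : 1 <= psum_prod p * limn T.
  have cv : (fun N => (limn T - T N) + psum_prodn N * limn T) @ \oo -->
      psum_prod p * limn T.
    rewrite -[X in _ --> X]add0r -{1}(subrr (limn T)); apply: cvgD.
      by apply: cvgB => //; exact: cvg_cst.
    by apply: cvgM; [exact: (psum_prodn_cvg p_gt0 F_cvg)|exact: cvg_cst].
  rewrite -(cvg_lim (@Rhausdorff R) cv); apply: limr_ge.
    by apply/cvg_ex; exists (psum_prod p * limn T).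
  exact: nearW.
rewrite lt_neqAle (psum_prod_ge0 p_gt0 F_cvg) andbT eq_sym => le1.
by apply/eqP => P0; move: le1; rewrite P0 mul0r ler10.
Qed.

End RenewalEquation.

(** * The expected first renewal number *)

Section FirstRenewal.
Context d (Omega : measurableType d) (R : realType) (P : probability Omega R).
Context (X : nat -> {RV P >-> nat}) (p : nat -> R).
Hypothesis p_gt0 : forall j, 0 < p j.
Hypothesis p_sum1 : (\sum_(0 <= j <oo) (p j)%:E = 1)%E.
Hypothesis X_iid : iid_samples X p.
Local Open Scope ereal_scope.

(** T_1 is the sum over i of the indicators of T_1 > i; both sides are infinite if there is no
    renewal. *)
Lemma first_renewalE (x : nat -> nat) :
  first_renewal R (shifted_perm x) = \sum_(0 <= i <oo) (no_renewal x i)%:R%:E.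
Proof.
have [[m0 ren]|noren] := pselect (exists m, (0 < m)%N && renews x m).
  have exm : exists m, (0 < m)%N && renews x m by exists m0.
  have [m /andP[m_gt0 ren_m] m_min] := ex_minnP exm.
  have nrE i : no_renewal x i = (i < m)%N.
    apply/no_renewalP/idP => [h|im j /andP[j0 ji]].
      rewrite ltnNge; apply/negP => mi; have := h m.
      by rewrite m_gt0 mi ren_m => /(_ isT).
    by apply/negP => rj; have := m_min j; rewrite j0 rj => /(_ isT); lia.
  have -> : first_renewal R (shifted_perm x) = m%:R%:E.
    apply/eqP; rewrite eq_le; apply/andP; split.
      by apply: ereal_inf_lbound; exists m => //; split=> //; apply/shifted_perm_image.
    apply: le_ereal_inf_tmp => _ [n [n0 /shifted_perm_image rn] <-].
    by rewrite lee_fin ler_nat; apply: m_min; rewrite n0 rn.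
  apply/esym/cvg_lim => //; apply: (cvg_near_cst); exists m => // n /= mn.
  rewrite sumEFin (big_cat_nat (n := m))//=.
  rewrite (@eq_big_nat _ _ _ 0%N m _ (fun=> 1%R)); last first.
    by move=> i /andP[_ im]; rewrite nrE im.
  rewrite sumr_const_nat subn0 big_nat_cond big1 ?addr0// => i /andP[/andP[mi _] _].
  by rewrite nrE ltnNge mi.
have nrE i : no_renewal x i.
  apply/no_renewalP => j /andP[j0 _]; apply/negP => rj.
  by apply: noren; exists j; rewrite j0.
have -> : first_renewal R (shifted_perm x) = +oo.
  rewrite /first_renewal (_ : [set _ | _ in _] = set0) ?ereal_inf0//.
  apply/seteqP; split=> // y [n [n0 /shifted_perm_image rn] _].
  by case: noren; exists n; rewrite n0.
apply/esym/eqP; rewrite -leye_eq leNgt; apply/negP.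
rewrite nneseries_ltyP => [[B hB]|i]; last exact: ler0n.
have [n Bn] : exists n : nat, (B < n%:R)%R.
  exists (Num.bound `|B|%R).
  by rewrite (le_lt_trans (ler_norm B))// archi_boundP.
have := hB n; rewrite (eq_bigr (fun=> 1%R)) => [|i _]; last by rewrite nrE.
by rewrite sumr_const_nat subn0 leNgt Bn.
Qed.

Lemma positive_recurrentP : 0 < (psum_prod p)%:E <-> positive_recurrent X.
Proof.
rewrite lte_fin (psum_prod_gt0_renewal p_gt0 p_sum1).
rewrite -nneseries_ltyP; last by move=> j; exact: no_renewal_prob_ge0.
rewrite /positive_recurrent.
suff -> : \int[P]_w first_renewal R (Pi X w) =
    \sum_(0 <= i <oo) (no_renewal_prob p i)%:E by [].
pose A i := [set w | no_renewal (nth 0%N (samples X 0 i w)) i].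
have mA i : measurable (A i).
  exact: (measurable_samples X i (fun t => no_renewal (nth 0%N t) i)).
have PA i : P (A i) = (no_renewal_prob p i)%:E.
  rewrite /no_renewal_prob fineK ?expect_pred_fin_num//.
  exact: (prob_samples p_gt0 X_iid i (fun t => no_renewal (nth 0%N t) i)).
under eq_eseriesr do rewrite -PA.
(* Exchanging integral and series turns E T_1 into the sum of the P(T_1 > i). *)
transitivity (\int[P]_w \sum_(0 <= i <oo) (\1_(A i) w)%:E).
  apply: eq_integral => w _; rewrite /Pi first_renewalE; apply: eq_eseriesr => i _.
  rewrite indicE; congr ((nat_of_bool _)%:R%:E).
  rewrite (eq_no_renewal (y := nth 0%N (samples X 0 i w))); last first.
    by move=> j ji; rewrite (nth_map 0%N) ?size_iota// nth_iota.
  by apply/idP/idP; rewrite in_setE.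
rewrite integral_nneseries//.
  by apply: eq_eseriesr => i _; rewrite integral_indic// setIT.
move=> i; apply/measurable_realfun.measurable_EFinP.
exact: measurable_realfun.measurable_indic.
Qed.

End FirstRenewal.

(** * The limits *)

Section Main.
Context d (Omega : measurableType d) (R : realType) (P : probability Omega R).
Context (X : nat -> {RV P >-> nat}) (p : nat -> R).
Hypothesis p_distr : positive_distribution p.
Hypothesis p_noninc : nonincreasing_seq p.
Hypothesis X_iid : iid_samples X p.
Local Open Scope ereal_scope.
Let p_gt0 := p_distr.1.
Let p_sum1 := p_distr.2.
Let F_cvg := psum_cvg1 p_gt0 p_sum1.
Let F_le1 := psum_le1 p_gt0 F_cvg.

Lemma proj_law_cvg l K : (0 < l)%N ->
  (fun n => proj_law X (clustered n l K.+1)) @ \oo -->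
  (limn (cluster_prob p l K))%:E.
Proof.
move=> l0; apply: (@cvg_trans _
    ((fun n => (cluster_prob p l K (n - (K + l)))%:E) @ \oo)).
  apply: near_eq_cvg; exists (K + l)%N => // n /= Kn.
  by rewrite (proj_law_clustered p_gt0 p_sum1 X_iid).
apply: cvg_EFin; first exact: nearW.
exact: cvg_comp (@cvg_subnr (K + l)%N) (cluster_prob_cvg p_gt0 F_cvg l0).
Qed.

Lemma lim_proj_law K :
  (fun l => limn (fun n => proj_law X (clustered n l K.+1))) @ \oo -->
  (psum_prodn p K * psum_prod p)%:E.
Proof.
apply: (@cvg_trans _ ((fun l => (limn (cluster_prob p l K))%:E) @ \oo)).
  apply: near_eq_cvg; exists 1%N => // l /= l0.
  by apply/esym; exact: (cvg_lim (@ereal_hausdorff R) (@proj_law_cvg l K l0)).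
apply: cvg_EFin; first exact: nearW.
exact: lim_cluster_prob.
Qed.

(** Here the numbers of values below and above the block both tend to infinity while [l] is fixed.
    The lower and upper bounds on [cluster_prob] then have explicit limits. *)
Lemma proj_law_liminf_limsup l (k : nat -> nat) : (0 < l)%N ->
  (forall n, (0 < k n)%N) -> minn (k n) (n - k n) @[n --> \oo] --> \oo ->
  let a n := proj_law X (clustered n l (k n)) in
  let b := (psum_prodn p l * psum_prodn p l.-1)%R in
  [/\ b%:E <= limn_einf a, limn_einf a <= limn_esup a &
    limn_esup a <= ((1 - p 0%N) ^+ l.-1 + b)%:E].
Proof.
move=> l0 k0 /cvgnyPge koo a b.
pose K n := (k n).-1; pose s n := (n - (K n + l))%N.
have Koo : K @ \oo --> \oo.
  apply/cvgnyPge => A; have := koo A.+1; apply: filterS => n.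
  by rewrite leq_min /K => /andP[kA _]; have := k0 n; lia.
have soo : s @ \oo --> \oo.
  apply/cvgnyPge => A; have := koo (A + l)%N; apply: filterS => n.
  by rewrite leq_min /s /K => /andP[_ kA]; have := k0 n; lia.
have aE : \forall n \near \oo, a n = (cluster_prob p l (K n) (s n))%:E.
  have := koo l; apply: filterS => n; rewrite leq_min => /andP[_ kl].
  rewrite /a -{1}(prednK (k0 n)) (proj_law_clustered p_gt0 p_sum1 X_iid)// /K.
  by have := k0 n; lia.
have bE : (fun n => ratio_prod p (K n) l * psum_prodn p l.-1)%R @ \oo --> b.
  apply: cvgM; last exact: cvg_cst.
  (* By symmetry the product has the fixed length [l] and tends to [psum_prodn p l], which yields
     the second copy of the infinite product. *)
  under eq_fun do rewrite ratio_prodC//.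
  exact: cvg_comp Koo (ratio_prod_cvg F_cvg (m := l)).
split; last 1 first.
- apply/lee_addgt0Pr => e e0; rewrite -EFinD.
  pose u n := ((1 - p 0%N) ^+ l.-1 + ratio_prod p (K n) l * psum_prodn p l.-1 + e)%R.
  have /cvg_EFin_comp/cvg_limn_einf_sup[_ <-] :
      u @ \oo --> ((1 - p 0%N) ^+ l.-1 + b + e)%R.
    by apply: cvgD; [apply: cvgD => //; exact: cvg_cst|exact: cvg_cst].
  apply: le_limn_esup.
  have := cluster_prob_eventually p_gt0 p_noninc F_cvg K l0 e0 soo.
  by apply: filterS2 aE => n -> ?; rewrite lee_fin.
- have [<- _] := cvg_limn_einf_sup (cvg_EFin_comp bE).
  apply: le_limn_einf; apply: filterS aE => n -> /=; rewrite lee_fin.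
  exact: (cluster_prob_lower p_gt0 F_le1).
- exact: limn_einf_sup.
Qed.

Lemma lim_liminf_limsup_proj_law (k : nat -> nat) : (forall n, (0 < k n)%N) ->
  minn (k n) (n - k n) @[n --> \oo] --> \oo ->
  let a l n := proj_law X (clustered n l (k n)) in
  (fun l => limn_einf (a l)) @ \oo --> (psum_prod p ^+ 2)%:E /\
  (fun l => limn_esup (a l)) @ \oo --> (psum_prod p ^+ 2)%:E.
Proof.
move=> k0 koo a.
pose b l := (psum_prodn p l * psum_prodn p l.-1)%R.
have bP : b @ \oo --> (psum_prod p ^+ 2)%R.
  by rewrite expr2; apply: cvgM; [exact: psum_prodn_cvg|exact: psum_prodn_pred_cvg].
have cP : (fun l => (1 - p 0%N) ^+ l.-1 + b l)%R @ \oo --> (psum_prod p ^+ 2)%R.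
  by rewrite -[X in _ --> X]add0r; apply: cvgD => //; exact: p0_exp_cvg.
have sq (u : nat -> \bar R) :
    (forall l, (0 < l)%N -> (b l)%:E <= u l <= ((1 - p 0%N) ^+ l.-1 + b l)%:E) ->
    u @ \oo --> (psum_prod p ^+ 2)%:E.
  move=> bu; apply: (squeeze_cvge _ (cvg_EFin_comp bP) (cvg_EFin_comp cP)).
  by exists 1%N => // l /= l0; exact: bu.
split; apply: sq => l l0; have [lo mid hi] := proj_law_liminf_limsup l0 k0 koo.
- by rewrite lo (le_trans mid hi).
- by rewrite hi (le_trans lo mid).
Qed.

End Main.

Unset Implicit Arguments.
Local Open Scope ereal_scope.

Theorem theorem3 (R : realType) (p : nat -> R)
    (p_distr : positive_distribution p)
    (p_noninc : nonincreasing_seq p)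
    (d : measure_display) (Omega : measurableType d)
    (P : probability Omega R) (X : nat -> {RV P >-> nat})
    (X_iid : iid_samples X p) :
  [/\ forall k : nat, (0 < k)%N ->
        let a (l n : nat) := proj_law X (clustered n l k) in
        [/\ forall l, (2 <= l)%N -> cvgn (a l),
            (fun l => limn (a l)) @ \oo -->
              ((\prod_(1 <= j < k) psum p j)%R * psum_prod p)%:E,
            0 < limn (fun l => limn (a l)) <-> first_moment p < +oo
          & 0 < limn (fun l => limn (a l)) <-> positive_recurrent X],
      forall k : nat -> nat, (forall n, (0 < k n)%N) ->
        minn (k n) (n - k n) @[n --> \oo] --> \oo ->
        let a (l n : nat) := proj_law X (clustered n l (k n)) in
        [/\ (fun l => limn_einf (a l)) @ \oo --> (psum_prod p ^+ 2)%:E,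
            (fun l => limn_esup (a l)) @ \oo --> (psum_prod p ^+ 2)%:E,
            (0 < limn (fun l => limn_einf (a l)) <-> first_moment p < +oo) /\
            (0 < limn (fun l => limn_einf (a l)) <-> positive_recurrent X)
          & (0 < limn (fun l => limn_esup (a l)) <-> first_moment p < +oo) /\
            (0 < limn (fun l => limn_esup (a l)) <-> positive_recurrent X)]
    & first_moment p < +oo <-> positive_recurrent X].
Proof.
have [p_gt0 p_sum1] := p_distr.
have F_cvg := psum_cvg1 p_gt0 p_sum1.
have prod_ge0 := psum_prod_ge0 p_gt0 F_cvg.
have momentP : (0 < psum_prod p)%R <-> first_moment p < +oo.
  exact: (first_momentP p_gt0 F_cvg).
have recurrentP : (0 < psum_prod p)%R <-> positive_recurrent X.
  by have := positive_recurrentP p_gt0 p_sum1 X_iid; rewrite lte_fin.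
have sqP : 0 < (psum_prod p ^+ 2)%:E <-> (0 < psum_prod p)%R.
  by rewrite lte_fin exprn_even_gt0// lt0r prod_ge0 andbT.
split; last by rewrite -momentP.
- case=> // K _ a.
  have lim_a := lim_proj_law p_distr p_noninc X_iid (K := K).
  have posP : 0 < limn (fun l => limn (a l)) <-> (0 < psum_prod p)%R.
    rewrite (cvg_lim (@ereal_hausdorff R) lim_a) lte_fin pmulr_rgt0//.
    exact: psum_prodn_gt0.
  split; [|exact: lim_a|by rewrite posP|by rewrite posP].
  move=> l l2; apply/cvg_ex; exists (limn (cluster_prob p l K))%:E.
  exact: (proj_law_cvg p_distr X_iid (K := K) (ltnW l2)).
- move=> k k0 koo a.
  have [inf_a sup_a] := lim_liminf_limsup_proj_law p_distr p_noninc X_iid k0 koo.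
  have infP := cvg_lim (@ereal_hausdorff R) inf_a.
  have supP := cvg_lim (@ereal_hausdorff R) sup_a.
  split; [exact: inf_a|exact: sup_a| |].
    by rewrite infP; split; rewrite sqP.
  by rewrite supP; split; rewrite sqP.
Qed.
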